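(* The following problem is undecidable: given eight $4\times4$ integer matrices with determinant one, decide whether the identity matrix $I_4$ belongs to the semigroup $S$ they generate.
   Context: The semigroup generated by a set of matrices is the set of all finite nonempty products of those matrices. *)

(* Defs.v *)
From mathcomp Require Import all_boot all_order all_algebra.

Set Implicit Arguments.
Unset Strict Implicit.
Unset Printing Implicit Defensive.

Import GRing.Theory.
Local Open Scope nat_scope.

(** Syntax of the (partial) mu-recursive functions, indexed by arity. *)
Inductive recfun : nat -> Type :=
| RZero n : recfun n
| RSucc : recfun 1
| RProj n (i : 'I_n) : recfun n
| RComp m n (f : recfun m) (g : 'I_m -> recfun n) : recfun n
| RPrec n (f : recfun n) (g : recfun n.+2) : recfun n.+1
| RMu n (f : recfun n.+1) : recfun n.

(** [h (0, x) = F x] and [h (k + 1, x) = G (k, h (k, x), x)], for partial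
    functions [F] and [G] given by their graphs. *)
Fixpoint prec_graph n (F : n.-tuple nat -> nat -> Prop)
    (G : n.+2.-tuple nat -> nat -> Prop) (k : nat) (x : n.-tuple nat)
    (z : nat) : Prop :=
  match k with
  | 0 => F x z
  | k'.+1 => exists2 y, prec_graph F G k' x y
                      & G (cons_tuple k' (cons_tuple y x)) z
  end.

(** [computes f x y]: the evaluation of [f] at [x] terminates with value [y]. *)
Fixpoint computes n (f : recfun n) : n.-tuple nat -> nat -> Prop :=
  match f in recfun n return n.-tuple nat -> nat -> Prop with
  | RZero _ => fun _ y => y = 0
  | RSucc => fun x y => y = (thead x).+1
  | RProj _ i => fun x y => y = tnth x i
  | RComp m _ f g => fun x z =>
      exists2 y : m.-tuple nat,
        (forall i, computes (g i) x (tnth y i)) & computes f y z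
  | RPrec _ f g => fun x z =>
      prec_graph (computes f) (computes g) (thead x) (behead_tuple x) z
  | RMu _ f => fun x k =>
      computes f (cons_tuple k x) 0 /\
      forall j, j < k -> exists y, computes f (cons_tuple j x) y.+1
  end.

(** The decision problem "given [x] satisfying [D], does [P x] hold?", where
    inputs are presented to the algorithm through [enc]. Nothing is required of
    the algorithm, not even termination, on inputs outside [D]. *)
Definition decidable_problem (T : Type) (k : nat) (enc : T -> k.-tuple nat)
    (D P : T -> Prop) : Prop :=
  exists f : recfun k, forall x : T, D x ->
    (P x -> computes f (enc x) 1) /\ (~ P x -> computes f (enc x) 0).

Definition undecidable_problem (T : Type) (k : nat) (enc : T -> k.-tuple nat)
    (D P : T -> Prop) : Prop :=
  ~ decidable_problem enc D P.

(** The bijection 0, -1, 1, -2, 2, ... |-> 0, 1, 2, 3, 4, ...; note that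
    [Negz m] is the integer [- (m + 1)]. *)
Definition int_code (z : int) : nat :=
  match z with
  | Posz m => m.*2
  | Negz m => m.*2.+1
  end.

(** The 8 * 16 entries, matrix by matrix and each matrix row by row. *)
Definition mx_code (A : 8.-tuple 'M[int]_4) : 128.-tuple nat :=
  [tuple int_code (tnth A (inord (j %/ 16))
                     (inord ((j %/ 4) %% 4)) (inord (j %% 4))) | j < 128].

Definition in_semigroup (R : pzRingType) (gens : seq R) (M : R) : Prop :=
  exists w : seq R,
    [/\ w <> [::], {subset w <= gens} & (\prod_(B <- w) B)%R = M].

(* Main.v *)
(** A partial recursive function [f] of [n] is run by a counter machine, the
    counter machine by a tag system, and the run of the tag system is coded by
    one equation between positive words,
      text(start) h(w) = codes(w) text(final),
    solvable in [w] iff the tag system halts.  Such an equation is decided by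
    the eight matrices, which are block diagonal with two blocks in SL(2, Z);
    each block uses a free family.  The letters [l] of [w] give four matrices
    (l, s h s^-1), the inverse codes give two, conjugated by extra free letters
    z and z' of the two blocks, and the last two are (z, s e z') and
    (z^-4, z'^-4).  A product equal to 1 has four times as many factors
    (z, s e z') as factors (z^-4, z'^-4), and cancellation in a free group only
    allows fewer than half of the former to fail the equation in each block; so
    one of them satisfies it in both blocks.

    The entries of the matrices are quadratic polynomials in [n].  If a
    decision procedure existed, it would be composed with the computation of
    the matrices whose coefficients are coded by [n] itself; evaluating this
    function [f] at the code of the coefficients belonging to [f] gives the
    contradiction. *)

From Stdlib Require Import FunctionalExtensionality.
Require Import Defs.
From mathcomp Require Import all_boot all_order all_algebra zify ring.

Set Implicit Arguments.
Unset Strict Implicit.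
Unset Printing Implicit Defensive.

Local Open Scope nat_scope.

(** * Tag systems and word equations *)

(** The number eight dictates the construction. Each letter of the tag system costs one rule for
    being read, one for being skipped and one inverse code, and two more matrices are needed for
    control; so only two letters are affordable. As the letter [false] merely reproduces itself, the
    whole counter program has to sit in the single production of [true], and information is carried
    by the offsets at which that production is entered. This is why the jump depends on the letter
    and why the production is laid out as a two-dimensional array.

    The exponent 4 is twice the number of blocks: in each block cancellation tolerates at most two
    failures per factor with [z^-4], less two overall, so four candidates per such factor leave one
    that succeeds in both.

    The diagonal argument needs no numbering of programs. Only the start of the equation depends on
    [n], through a power of a unipotent matrix, so 384 integers describe all the matrices attached
    to a function; these integers, and not a text of the function, are what [n] codes. *)

Section Tag.
Variables (jump : bool -> nat) (bl : bool -> seq bool).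
Hypothesis jump0 : forall l, 0 < jump l.

Definition tconfig := (nat * seq bool)%type.
Definition appended (l : bool) : seq bool := rcons (bl l) l.

(* In configuration [(o, w)] the next [o] letters of [w] are deleted without
   being read; the letter after them is read, and deleted together with the
   following [jump l - 1]. *)
Definition tnext (c : tconfig) : tconfig :=
  match c.2 with
  | l :: (_ :: _) as w' =>
    if c.1 is o.+1 then (o, behead c.2) else ((jump l).-1, behead c.2 ++ appended l)
  | _ => c
  end.

Definition Ll (l : bool) : nat := if l then 0 else 1.
Definition code (l : bool) : seq nat := Ll l :: nseq (jump l).-1 2.
Definition codes (q : seq bool) : seq nat := flatten (map code q).
(** The flag guesses whether the letter is read or skipped. Reading appends the production without
    the fillers of its last letter; each later skip supplies one of them. *)
Definition hrule (m : bool * bool) : seq nat :=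
  if m.1 then codes (bl m.2) ++ [:: Ll m.2] else [:: 2].
Definition hrules (w : seq (bool * bool)) : seq nat := flatten (map hrule w).

(* The last letter of the configuration carries the offset [o], as missing
   copies of the filler letter 2. *)
Fixpoint textaux o (x : bool) (q : seq bool) : seq nat :=
  if q is y :: q' then code x ++ textaux o y q' else Ll x :: nseq ((jump x).-1 - o) 2.
Definition text (c : tconfig) : seq nat :=
  if c.2 is x :: q then textaux c.1 x q else [::].

Definition twf (c : tconfig) := if c.2 is x :: q then c.1 < jump (last x q) else false.

Lemma codes_cat u v : codes (u ++ v) = codes u ++ codes v.
Proof. by rewrite /codes map_cat flatten_cat. Qed.

Lemma textaux_last o x q : textaux o x q =
  codes (belast x q) ++ Ll (last x q) :: nseq ((jump (last x q)).-1 - o) 2.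
Proof. by elim: q x => //= y q IH x; rewrite IH /codes /= -!catA. Qed.

Lemma text_rcons o q y : text (o, rcons q y) = codes q ++ Ll y :: nseq ((jump y).-1 - o) 2.
Proof. by case: q => [|x q] //; rewrite /text /= textaux_last belast_rcons last_rcons. Qed.

Lemma twf_rcons o q y : twf (o, rcons q y) = (o < jump y).
Proof. by case: q => //= x q; rewrite /twf /= last_rcons. Qed.

Lemma tnext_wf c : twf c -> twf (tnext c).
Proof.
case: c => o [|l [|m q]] //= wf; case: o wf => [|o] /= wf.
  by rewrite /tnext /= -cat_cons /appended -rcons_cat twf_rcons prednK.
by rewrite /twf /=; apply: ltnW.
Qed.

Lemma text_step c : twf c -> 1 < size c.2 ->
  text c ++ hrule (c.1 == 0, head false c.2) = code (head false c.2) ++ text (tnext c).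
Proof.
case: c => o [|l [|m q]] //= wf _; rewrite /text /= -catA; congr (_ :: (_ ++ _)).
case: o wf => [|o] wf; rewrite /tnext /=.
  rewrite /hrule /= -[textaux _ _ _]/(text (0, m :: q)) lastI text_rcons subn0.
  rewrite -[textaux _ _ _]/(text (_, m :: (q ++ appended l))) -cat_cons /appended -rcons_cat text_rcons.
  rewrite subnn codes_cat (lastI m q) -[rcons _ (last m q)]cats1 codes_cat -!catA.
  by rewrite /codes /=.
rewrite !textaux_last -catA /hrule /=; congr (_ ++ _ :: _).
by rewrite -[[:: 2]]/(nseq 1 2) -nseqD; congr nseq; move: wf; rewrite /twf /=; lia.
Qed.

Lemma tag_complete n c fin : twf c -> iter n tnext c = fin ->
  exists w, text c ++ hrules w = codes (map snd w) ++ text fin.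
Proof.
elim: n c => [|n IH] c wf /=; first by move=> <-; exists [::]; rewrite cats0.
rewrite -iterS iterSr => E.
have [sz|sz] := ltnP 1 (size c.2).
  have [|w Ew] := IH (tnext c) (tnext_wf wf); first by [].
  exists ((c.1 == 0, head false c.2) :: w).
  by rewrite /hrules /= catA text_step // -catA Ew /codes /= catA.
have fx : tnext c = c by case: c sz {wf E} => o [|l [|m q]].
exists [::]; rewrite cats0 -E fx /=; congr text.
by elim: n {IH E} => //= n <-.
Qed.

Lemma catI (T : Type) (u v v' : seq T) : u ++ v = u ++ v' -> v = v'.
Proof. by move/(congr1 (drop (size u))); rewrite !drop_size_cat. Qed.

Definition lhead (t : seq nat) := head 0 t != 2.

Lemma nseq2_inj a b u v : lhead u -> lhead v -> nseq a 2 ++ u = nseq b 2 ++ v -> a = b /\ u = v.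
Proof.
elim: a b => [|a IH] [|b] //= hu hv.
- by move=> E; rewrite /lhead E in hu.
- by move=> E; rewrite /lhead -E in hv.
by case=> /(IH b hu hv) [-> ->].
Qed.

Lemma lhead_Ll x t : lhead (Ll x :: t). Proof. by case: x. Qed.

Lemma Ll_inj : injective Ll. Proof. by case; case. Qed.

(** The shape of [codes g] followed by the text of a one-letter configuration: every letter but the
    last has its full number of fillers. A wrong flag in a rule destroys this shape. *)
Definition blocks (t : seq nat) :=
  exists g y k, k <= (jump y).-1 /\ t = codes g ++ Ll y :: nseq k 2.

Lemma blocks_cons l m t : lhead t -> blocks (Ll l :: nseq m 2 ++ t) ->
  (t = [::] /\ m <= (jump l).-1) \/ (m = (jump l).-1 /\ blocks t).
Proof.
move=> ht [[|x g] [y [k [ky]]]] /= [/Ll_inj ->].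
  rewrite -[nseq k 2]cats0 => /nseq2_inj [] // -> ->; left; split=> //.
rewrite -catA => /nseq2_inj [] //.
  by case: g => [|x' g]; rewrite /= ?lhead_Ll.
by move=> -> ->; right; split => //; exists g, y, k.
Qed.

Lemma blocks_codes q t : lhead t -> t <> [::] -> blocks (codes q ++ t) -> blocks t.
Proof.
move=> ht t0; elim: q => //= x q IH; rewrite /codes /= -catA => /blocks_cons [].
- by case: q {IH} => //= y q; apply: lhead_Ll.
- by case; case: q {IH} => //= -[].
by case=> _; apply: IH.
Qed.

Lemma nseq2_split t : exists m t', lhead t' /\ t = nseq m 2 ++ t'.
Proof.
elim: t => [|x t [m [t' [h ->]]]]; first by exists 0, [::].
have [-> | x2] := eqVneq x 2; first by exists m.+1, t'.
by exists 0, (x :: nseq m 2 ++ t').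
Qed.

(** Comparing first entries forces the letter of each rule, and a wrong flag gives some letter too
    many or too few fillers. So [w] has to follow the actual run, whose configurations are all too
    long to match [fin] at the end. *)
Lemma tag_sound c fin : twf c -> twf fin -> size fin.2 = 1 ->
  (forall n, 1 < size (iter n tnext c).2) ->
  forall w, text c ++ hrules w <> codes (map snd w) ++ text fin.
Proof.
move=> wf wff szf big w; elim: w c wf big => [|[a l] w IH] c wf big.
  rewrite cats0 /= => E; have := big 0 => /=.
  have cnt d : twf d -> count (fun i => i != 2) (text d) = size d.2.
    case: d => o q; case/lastP: q => [//|q y] _; rewrite text_rcons size_rcons count_cat /=.
    have -> : count (fun i => i != 2) (nseq ((jump y).-1 - o) 2) = 0 by rewrite count_nseq.
    have -> : count (fun i => i != 2) (codes q) = size q.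
      by rewrite /codes; elim: q => //= x q IH; rewrite count_cat IH count_nseq; case: x.
    by case: y; rewrite /=; lia.
  by rewrite -cnt // E cnt // szf.
move=> E; have sz := big 0; rewrite /= in sz.
have lE : l = head false c.2.
  move: E; case: c sz {wf big} => o [|x [|y q]] //= _; rewrite /text /=.
  by case=> /Ll_inj.
have EH : hrules ((a, l) :: w) = hrule (a, l) ++ hrules w by [].
have EL : codes (map snd ((a, l) :: w)) = code l ++ codes (map snd w) by [].
have [ao|ao] := eqVneq a (c.1 == 0).
  apply: (IH (tnext c)); first exact: tnext_wf.
    by move=> n; rewrite -iterSr; apply: big.
  by move: E; rewrite EH EL ao lE catA text_step // -!catA => /catI.
move: E; rewrite EH EL; case: c wf {IH big} sz ao lE => o [|x [|y q]] //= wf _ ao ->.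
move=> E0; have /catI : code x ++ (textaux o y q ++ hrule (a, x) ++ hrules w) =
    code x ++ (codes (map snd w) ++ text fin).
  by rewrite catA [RHS]catA; exact: E0.
rewrite {E0}textaux_last => E.
have : blocks (codes (belast y q) ++ Ll (last y q) ::
   nseq ((jump (last y q)).-1 - o) 2 ++ hrule (a, x) ++ hrules w).
  move: E; rewrite -catA cat_cons => ->.
  case: fin wff szf => of' [|z [|]] //= wff _; exists (map snd w), z, ((jump z).-1 - of').
  by rewrite leq_subr.
move/blocks_codes; rewrite lhead_Ll => /(_ isT) H; move: {H}(H ltac:(discriminate)).
(* A skip at offset 0 adds one filler too many; a read at a positive offset starts a new letter
   before the fillers of the last one are complete. *)
move: wf; rewrite /twf /=; case: o a ao {EH EL E} => [|o] [] //= _ wf.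
  have [m [t' [ht' Et]]] := nseq2_split (hrules w).
  rewrite Et subn0 /= -[2 :: _]/(nseq m.+1 2 ++ t') catA -nseqD.
  by move/blocks_cons => /(_ ht') [] [] *; have := jump0 (last y q); lia.
move=> /blocks_cons [].
- by rewrite /hrule /= -!catA; case: (bl x) => [|z b] /=; apply: lhead_Ll.
- by case; rewrite /hrule /=; case: (bl x).
by case; lia.
Qed.

End Tag.

(** * Counter programs for recursive functions *)

Definition state := nat -> nat.
Definition upd (st : state) (r v : nat) : state := fun i => if i == r then v else st i.

Inductive cmd := Skip | Inc of nat | Seq of cmd & cmd | Loop of nat & cmd.

(* [Loop r c] is "while r > 0 do { r := r - 1; c }". *)
Inductive exec : cmd -> state -> state -> Prop :=
| ESkip st : exec Skip st st
| EInc r st : exec (Inc r) st (upd st r (st r).+1)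
| ESeq c1 c2 st st1 st2 : exec c1 st st1 -> exec c2 st1 st2 -> exec (Seq c1 c2) st st2
| ELoop0 r c st : st r = 0 -> exec (Loop r c) st st
| ELoopS r c v st st1 st2 : st r = v.+1 -> exec c (upd st r v) st1 ->
    exec (Loop r c) st1 st2 -> exec (Loop r c) st st2.

Ltac upd_tac := apply: functional_extensionality => ?; rewrite /upd;
  repeat (case: eqP => ? //=; subst => //); try lia.

Ltac upd_scratch stk := upd_tac; try (rewrite ?stk; lia).

Lemma upd_same st r v : upd st r v r = v. Proof. by rewrite /upd eqxx. Qed.
Lemma upd_other st r v i : i != r -> upd st r v i = st i.
Proof. by rewrite /upd => /negbTE ->. Qed.

Lemma exec_eq c st st1 st2 : exec c st st1 -> st1 = st2 -> exec c st st2.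
Proof. by move=> e <-. Qed.

Definition clear a := Loop a Skip.
Definition move a b := Loop a (Inc b).
Definition copy a b t := Seq (Loop a (Seq (Inc t) (Inc b))) (move t a).

Lemma exec_clear a st : exec (clear a) st (upd st a 0).
Proof.
move E: (st a) => v; elim: v st E => [|v IH] st E.
  by apply: exec_eq (ELoop0 _ E) _; upd_tac.
apply: ELoopS E (ESkip _) _.
by apply: exec_eq; [apply: IH; rewrite upd_same | upd_tac].
Qed.

Lemma exec_move a b st : a != b -> exec (move a b) st (upd (upd st b (st b + st a)) a 0).
Proof.
move=> /eqP ab; move E: (st a) => v; elim: v st E => [|v IH] st E.
  by apply: exec_eq (ELoop0 _ E) _; upd_tac.
apply: ELoopS E (EInc _ _) _.
by apply: exec_eq; [apply: IH; rewrite /upd; case: eqP; rewrite ?eqxx // | upd_tac].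
Qed.

Lemma exec_copy a b t st : a != b -> a != t -> b != t -> st b = 0 -> st t = 0 ->
  exec (copy a b t) st (upd st b (st a)).
Proof.
move=> /eqP ab /eqP at' /eqP bt b0 t0.
have P1 : exec (Loop a (Seq (Inc t) (Inc b))) st
    (upd (upd (upd st t (st t + st a)) b (st b + st a)) a 0).
  move E: (st a) => v; elim: v st E {b0 t0} => [|v IH] st E.
    by apply: exec_eq (ELoop0 _ E) _; upd_tac.
  apply: ELoopS E (ESeq (EInc _ _) (EInc _ _)) _.
  apply: exec_eq; first by apply: IH; rewrite /upd; do 3?case: eqP; rewrite ?eqxx.
  by upd_tac.
apply: ESeq P1 _; apply: exec_eq; first by apply: exec_move; rewrite eq_sym; apply/eqP.
by rewrite t0 b0; upd_tac.
Qed.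

Definition seqs (cs : seq cmd) : cmd := foldr Seq Skip cs.

(* [compile f args out k] computes [f] from the registers [args 0, args 1, ...]
   into [out]; the registers from [k] on are scratch space. *)
Fixpoint compile n (f : recfun n) : (nat -> nat) -> nat -> nat -> cmd :=
  match f with
  | RZero _ => fun _ _ _ => Skip
  | RSucc => fun args out k => Seq (copy (args 0) out k) (Inc out)
  | RProj _ i => fun args out k => copy (args i) out k
  | RComp m _ f g => fun args out k =>
      Seq (seqs [seq compile (g i) args (k + i) (k + m) | i <- enum 'I_m])
        (Seq (compile f (addn k) out (k + m)) (seqs [seq clear (k + i) | i <- iota 0 m]))
  | RPrec _ f g => fun args out k =>
      Seq (compile f (fun i => args i.+1) k.+1 k.+4)
        (Seq (copy (args 0) k.+3 k.+4)
          (Seq (Loop k.+3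
            (Seq (compile g (fun i => match i with 0 => k | 1 => k.+1 | j.+2 => args j.+1 end)
                    k.+2 k.+4)
              (Seq (clear k.+1) (Seq (move k.+2 k.+1) (Inc k)))))
            (Seq (clear k) (move k.+1 out))))
  | RMu _ f => fun args out k =>
      Seq (Inc k.+2)
        (Seq (Loop k.+2
          (Seq (compile f (fun i => if i is j.+1 then args j else k) k.+1 k.+3)
               (Loop k.+1 (Seq (clear k.+1) (Seq (Inc k.+2) (Inc k))))))
          (move k out))
  end.

(** Every register other than [out] ends as it began, so scratch space is zero again and can be used
    by the next subprogram. *)
Definition comp_spec n (f : recfun n) := forall x y, computes f x y ->
  forall args out k st, (forall i, i < n -> args i < k) -> out < k ->
  (forall i, i < n -> args i != out) -> (forall r, k <= r -> st r = 0) -> st out = 0 ->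
  (forall i : 'I_n, st (args i) = tnth x i) ->
  exec (compile f args out k) st (upd st out y).

Lemma comp_RComp n m (f : recfun m) (g : 'I_m -> recfun n) :
  comp_spec f -> (forall i, comp_spec (g i)) -> comp_spec (RComp f g).
Proof.
move=> Hf Hg x z /= [y Hy Hz] args out k st ak ok ao stk sto sta.
pose S j : state := fun r => if (k <= r < k + j) then nth 0 y (r - k) else st r.
have P1 j : j <= m -> exec (seqs [seq compile (g i) args (k + i) (k + m) | i <- drop j (enum 'I_m)]) (S j) (S m).
  move=> jm; move E: (m - j) => d; elim: d j jm E => [|d IH] j jm E.
    have -> : j = m by lia.
    by rewrite drop_oversize ?size_enum_ord //=; apply: ESkip.
  have jm' : j < m by lia.
  rewrite (drop_nth (Ordinal jm')) ?size_enum_ord //= nth_enum_ord //.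
  have -> : nth (Ordinal jm') (enum 'I_m) j = Ordinal jm' by apply: val_inj; rewrite /= nth_enum_ord.
  have Sj1 : S j.+1 = upd (S j) (k + j) (tnth y (Ordinal jm')).
    apply: functional_extensionality => r; rewrite /S /upd (tnth_nth 0) /=.
    case: eqP => [->|ne]; first by rewrite addKn; case: ifP => //; lia.
    by do 2!case: ifP => //; lia.
  apply: (ESeq (st1 := S j.+1)); last by apply: IH; lia.
  rewrite Sj1; apply: (Hg _ _ _ (Hy _)).
  - by move=> i /ak; lia.
  - by lia.
  - by move=> i /ak; lia.
  - by move=> r kr; rewrite /S; case: ifP; [lia | move=> _; apply: stk; lia].
  - by rewrite /S; case: ifP; [lia | move=> _; apply: stk; lia].
  - by move=> i; rewrite -sta /S; case: ifP => //; have := ak i (ltn_ord i); lia.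
have S0 : S 0 = st by apply: functional_extensionality => r; rewrite /S; case: ifP => //; lia.
apply: (ESeq (st1 := S m)); first by have := P1 0 isT; rewrite drop0 S0.
have So : S m out = 0 by rewrite /S; case: ifP => //; lia.
apply: (ESeq (st1 := upd (S m) out z)).
  apply: (Hf _ _ Hz) => //.
  - by move=> i im; lia.
  - by lia.
  - by move=> i im; lia.
  - by move=> r kr; rewrite /S; case: ifP; [lia | move=> _; apply: stk; lia].
  - move=> i; rewrite /S (tnth_nth 0) addKn; case: ifP => //; have := ltn_ord i; lia.
have P2 s st' : exec (seqs [seq clear (k + i) | i <- s]) st' (fun r => if (k <= r) && (r - k \in s) then 0 else st' r).
  elim: s st' => [|i s IH] st' /=; first by apply: exec_eq (ESkip _) _; apply: functional_extensionality => r; rewrite andbF.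
  apply: ESeq (exec_clear _ _) _; apply: exec_eq (IH _) _.
  apply: functional_extensionality => r; rewrite /upd inE.
  have -> : (k <= r) && ((r - k == i) || (r - k \in s)) = (r == k + i) || ((k <= r) && (r - k \in s)).
    by case: (r - k \in s); rewrite ?orbT ?orbF ?andbT ?andbF; lia.
  by case: eqP => //= _; case: ifP.
apply: exec_eq (P2 _ _) _; apply: functional_extensionality => r; rewrite /upd mem_iota /S.
case: (r =P out) => [->|_]; first by case: ifP => //; lia.
case: ifP => // h; first by rewrite stk //; lia.
by case: ifP => // h'; lia.
Qed.

Lemma comp_RPrec n (f : recfun n) (g : recfun n.+2) :
  comp_spec f -> comp_spec g -> comp_spec (RPrec f g).
Proof.
move=> Hf Hg x z /= Hz args out k st ak ok ao stk sto sta.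
have a0 := ak 0 isT; have ao0 := ao 0 isT.
have st0 : st (args 0) = thead x by rewrite (sta ord0).
have stx (i : 'I_n) : st (args i.+1) = tnth (behead_tuple x) i.
  have := sta (lift ord0 i); rewrite /= => ->; rewrite !(tnth_nth 0) /=.
  by rewrite nth_behead.
(* Rounds done in [k], current value in [k+1], rounds left in [k+3]; [k+2] receives the next
   value. *)
pose I j y t : state := upd (upd (upd st k j) k.+1 y) k.+3 t.
have P1 y : computes f (behead_tuple x) y -> exec (compile f (fun i => args i.+1) k.+1 k.+4) st (I 0 y 0).
  move=> Hy; apply: exec_eq; first apply: (Hf _ _ Hy) => //.
  - by move=> i /= im; have := ak i.+1 im; lia.
  - by lia.
  - by move=> i im; have := ak i.+1 im; lia.
  - by move=> r kr; apply: stk; lia.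
  - by apply: stk.
  by rewrite /I; have := stk k; have := stk k.+3; move=> *; upd_tac; rewrite stk //; lia.
have P2 y : exec (copy (args 0) k.+3 k.+4) (I 0 y 0) (I 0 y (thead x)).
  apply: exec_eq; first apply: exec_copy; try lia.
  - by rewrite /I upd_same.
  - by rewrite /I !upd_other ?stk //; lia.
  by rewrite /I !(upd_other _ _ (i := args 0)) ?st0; try lia; upd_tac.
(* [prec_graph] unfolds from the last round backwards, while the loop runs forwards. The induction
   therefore takes the rest of the execution as given and prepends rounds to it. *)
have P4 m : forall y, prec_graph (computes f) (computes g) m (behead_tuple x) y ->
   exists2 y0, computes f (behead_tuple x) y0 & forall e st',
   exec (Loop k.+3
            (Seq (compile g (fun i => match i with 0 => k | 1 => k.+1 | j.+2 => args j.+1 end)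
                    k.+2 k.+4)
              (Seq (clear k.+1) (Seq (move k.+2 k.+1) (Inc k))))) (I m y e) st' ->
   exec (Loop k.+3
            (Seq (compile g (fun i => match i with 0 => k | 1 => k.+1 | j.+2 => args j.+1 end)
                    k.+2 k.+4)
              (Seq (clear k.+1) (Seq (move k.+2 k.+1) (Inc k))))) (I 0 y0 (m + e)) st'.
  elim: m => [|m IH] y /=; first by move=> Hy; exists y.
  case=> y1 /IH [y0 Hy0 H0] Hy; exists y0 => // e st' L.
  rewrite addSnnS; apply: H0; apply: (@ELoopS _ _ e _ (I m.+1 y e)) L; first by rewrite /I upd_same.
  have -> : upd (I m y1 e.+1) k.+3 e = I m y1 e by rewrite /I; upd_tac.
  apply: (ESeq (st1 := upd (I m y1 e) k.+2 y)).
    apply: (Hg _ _ Hy) => //.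
    - by move=> [|[|i]] /= im; try lia; have := ak i.+1 im; lia.
    - by move=> [|[|i]] /= im; try lia; have := ak i.+1 im; lia.
    - by move=> r kr; rewrite /I !upd_other ?stk //; lia.
    - by rewrite /I !upd_other ?stk //; lia.
    case=> [[|[|i]] lti]; rewrite (tnth_nth 0) /= /I.
    - by rewrite /upd; repeat (case: eqP => ? //); lia.
    - by rewrite /upd; repeat (case: eqP => ? //); lia.
    have lti' : i < n by [].
    have := ak i.+1 lti => ai; rewrite !upd_other; try lia.
    by have := stx (Ordinal lti'); rewrite (tnth_nth 0).
  apply: ESeq (exec_clear _ _) _; apply: ESeq; first by apply: exec_move; lia.
  apply: exec_eq (EInc _ _) _; rewrite /I.
  by upd_scratch stk.
have [y0 Hy0 H0] := P4 _ _ Hz.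
apply: ESeq (P1 _ Hy0) _; apply: ESeq (P2 _) _.
apply: (ESeq (st1 := I (thead x) z 0)).
  by have := H0 0; rewrite addn0; apply; apply: ELoop0; rewrite /I upd_same.
apply: ESeq (exec_clear _ _) _; apply: exec_eq; first by apply: exec_move; lia.
by rewrite /I; upd_scratch stk.
Qed.

Lemma comp_RMu n (f : recfun n.+1) : comp_spec f -> comp_spec (RMu f).
Proof.
move=> Hf x z /= [Hz Hlt] args out k st ak ok ao stk sto sta.
(* Candidate in [k], value of [f] at it in [k+1], and in [k+2] a flag asking for another round. The
   inner loop on [k+1] serves as a conditional, since its body clears that register. *)
pose I j t : state := upd (upd st k j) k.+2 t.
have body j y : computes f (cons_tuple j x) y -> exec (compile f (fun i => if i is j.+1 then args j else k) k.+1 k.+3)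
    (I j 0) (upd (I j 0) k.+1 y).
  move=> Hy; apply: (Hf _ _ Hy) => //.
  - by move=> [|i] /= im; try lia; have := ak i im; lia.
  - by move=> [|i] /= im; try lia; have := ak i im; lia.
  - by move=> r kr; rewrite /I !upd_other ?stk //; lia.
  - by rewrite /I !upd_other ?stk //; lia.
  case=> [[|i] lti]; rewrite (tnth_nth 0) /= /I.
  - by rewrite /upd; repeat (case: eqP => ? //); lia.
  have ai := ak i lti; rewrite !upd_other; try lia.
  by have := sta (Ordinal (lti : i < n)); rewrite (tnth_nth 0).
have loop d : forall j, j + d = z -> exec (Loop k.+2
          (Seq (compile f (fun i => if i is j.+1 then args j else k) k.+1 k.+3)
               (Loop k.+1 (Seq (clear k.+1) (Seq (Inc k.+2) (Inc k)))))) (I j 1) (I z 0).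
  elim: d => [|d IH] j jd.
    have -> : j = z by lia.
    apply: (@ELoopS _ _ 0 _ (I z 0)); [by rewrite /I upd_same | | by apply: ELoop0; rewrite /I upd_same].
    have -> : upd (I z 1) k.+2 0 = I z 0 by rewrite /I; upd_tac.
    apply: ESeq (body _ _ Hz) _; apply: exec_eq; first by apply: ELoop0; rewrite upd_same.
    by rewrite /I; upd_scratch stk.
  have [|y Hy] := Hlt j; first by lia.
  apply: (@ELoopS _ _ 0 _ (I j.+1 1)); [by rewrite /I upd_same | | by apply: IH; lia].
  have -> : upd (I j 1) k.+2 0 = I j 0 by rewrite /I; upd_tac.
  apply: ESeq (body _ _ Hy) _; apply: (@ELoopS _ _ y _ (I j.+1 1)); first by rewrite upd_same.
    apply: ESeq (exec_clear _ _) _; apply: ESeq (EInc _ _) _; apply: exec_eq (EInc _ _) _.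
    by rewrite /I; upd_scratch stk.
  by apply: ELoop0; rewrite /I !upd_other ?stk //; lia.
have E1 : upd st k.+2 (st k.+2).+1 = I 0 1.
  by rewrite /I; upd_scratch stk.
apply: ESeq; first by apply: EInc.
rewrite E1; apply: ESeq (loop z 0 erefl) _; apply: exec_eq; first by apply: exec_move; lia.
by rewrite /I; upd_scratch stk.
Qed.

Lemma comp_ok n (f : recfun n) : comp_spec f.
Proof.
elim: f => {n}.
- by move=> n x y /= -> args out k st *; apply: exec_eq (ESkip _) _; upd_tac.
- move=> x y /= -> args out k st ak ok ao stk sto sta.
  have a0 := ak 0 isT; have ao0 := ao 0 isT.
  apply: ESeq; first by apply: exec_copy; [lia | lia | lia | exact: sto | exact: stk].
  apply: exec_eq (EInc _ _) _; rewrite upd_same (sta ord0) /thead; upd_tac.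
- move=> n i x y /= -> args out k st ak ok ao stk sto sta; rewrite -sta.
  have ai := ak i (ltn_ord i); have aoi := ao i (ltn_ord i).
  by apply: exec_copy; [lia | lia | lia | exact: sto | exact: stk].
- by move=> m n f Hf g Hg; apply: comp_RComp.
- by move=> n f Hf g Hg; apply: comp_RPrec.
by move=> n f Hf; apply: comp_RMu.
Qed.

(** * Flat counter machines *)

Inductive instr := INC of nat & nat | DEC of nat & nat & nat | JMP of nat.

(** By the default, a position past the end jumps to itself, so halting is a fixed point of
    [mstep]. *)
Definition instr_at (prog : seq instr) q := nth (JMP q) prog q.

Definition mstep (prog : seq instr) (c : nat * state) : nat * state :=
  match instr_at prog c.1 with
  | INC r q => (q, upd c.2 r (c.2 r).+1)
  | DEC r q1 q0 => if c.2 r is v.+1 then (q1, upd c.2 r v) else (q0, c.2)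
  | JMP q => (q, c.2)
  end.

Definition wf_instr qn R (i : instr) :=
  match i with
  | INC r q => (r < R) && (q <= qn)
  | DEC r q1 q0 => [&& r < R, q1 <= qn & q0 <= qn]
  | JMP q => q <= qn
  end.

Fixpoint csize c :=
  match c with
  | Skip => 0 | Inc _ => 1 | Seq c1 c2 => csize c1 + csize c2 | Loop _ c => (csize c).+2
  end.

Fixpoint creg c :=
  match c with
  | Skip => 0 | Inc r => r | Seq c1 c2 => maxn (creg c1) (creg c2)
  | Loop r c => maxn r (creg c)
  end.

Fixpoint flat c p : seq instr :=
  match c with
  | Skip => [::]
  | Inc r => [:: INC r p.+1]
  | Seq c1 c2 => flat c1 p ++ flat c2 (p + csize c1)
  | Loop r c => DEC r p.+1 (p + (csize c).+2) :: flat c p.+1 ++ [:: JMP p]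
  end.

Lemma size_flat c p : size (flat c p) = csize c.
Proof.
elim: c p => //= [c1 IH1 c2 IH2|r c IH] p; first by rewrite size_cat IH1 IH2.
by rewrite size_cat IH addn1.
Qed.

Lemma flat_wf c p qn R : p + csize c <= qn -> creg c < R -> all (wf_instr qn R) (flat c p).
Proof.
elim: c p => //= [r|c1 IH1 c2 IH2|r c IH] p le.
- by move=> ->; rewrite andbT; lia.
- by rewrite gtn_max => /andP[r1 r2]; rewrite all_cat IH1 ?IH2 //; lia.
rewrite gtn_max => /andP[-> r2]; rewrite all_cat IH //=; lia.
Qed.

Lemma instr_at_cat u i v : instr_at (u ++ i :: v) (size u) = i.
Proof. by rewrite /instr_at nth_cat ltnn subnn. Qed.

Lemma flat_exec c st st' : exec c st st' -> forall u v,
  exists m, iter m (mstep (u ++ flat c (size u) ++ v)) (size u, st) = (size u + csize c, st').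
Proof.
elim=> {c st st'} [st|r st|c1 c2 st st1 st2 _ IH1 _ IH2|r c st E|r c w st st1 st2 E _ IH1 _ IH2] u v /=.
- by exists 0; rewrite addn0.
- by exists 1; rewrite /= /mstep instr_at_cat addn1.
- have [m1 E1] := IH1 u (flat c2 (size u + csize c1) ++ v).
  have [m2] := IH2 (u ++ flat c1 (size u)) v.
  rewrite size_cat size_flat -!catA => E2.
  by exists (m2 + m1); rewrite iterD E1 E2 addnA.
- by exists 1; rewrite /= /mstep instr_at_cat /= E.
have [m1] := IH1 (u ++ [:: DEC r (size u).+1 (size u + (csize c).+2)]) (JMP (size u) :: v).
have [m2] := IH2 u v.
rewrite size_cat addn1 -!catA /= -!catA => E2 E1.
exists (m2 + (1 + (m1 + 1))); rewrite !iterD.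
have -> : iter 1 (mstep (u ++ DEC r (size u).+1 (size u + (csize c).+2) :: flat c (size u).+1 ++ [:: JMP (size u)] ++ v)) (size u, st) = ((size u).+1, upd st r w).
  by rewrite /= /mstep instr_at_cat /= E.
rewrite E1 -E2; congr (iter m2 _ _).
have -> : u ++ DEC r (size u).+1 (size u + (csize c).+2) :: flat c (size u).+1 ++ [:: JMP (size u)] ++ v = (u ++ DEC r (size u).+1 (size u + (csize c).+2) :: flat c (size u).+1) ++ JMP (size u) :: v.
  by rewrite -catA.
have -> : (size u).+1 + csize c = size (u ++ DEC r (size u).+1 (size u + (csize c).+2) :: flat c (size u).+1).
  by rewrite size_cat /= size_flat; lia.
by rewrite /= /mstep instr_at_cat.
Qed.

(** * The machine of a unary function *)

Definition main_cmd (f : recfun 1) :=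
  Seq (compile f (fun _ => 0) 1 2) (Seq (clear 0) (Loop 1 (Inc 1))).
(** The last loop of [main_cmd] never ends on a positive value, and on the value 0 the machine halts
    with all registers 0. The leading jump gives the pass that turns the input word into windows an
    instruction that leaves the offset unchanged. *)
Definition main_prog f := JMP 1 :: flat (main_cmd f) 1.
Definition input n : state := upd (fun _ => 0) 0 n.

Lemma size_main f : size (main_prog f) = 1 + csize (main_cmd f).
Proof. by rewrite /main_prog /= -[csize _ + _]/(csize (main_cmd f)) -(size_flat (main_cmd f) 1). Qed.

Lemma main_wf f : all (wf_instr (size (main_prog f)) (creg (main_cmd f)).+1) (main_prog f).
Proof.
by rewrite size_main /main_prog -cat1s all_cat flat_wf // andbT.
Qed.

Lemma main_comp f n y : computes f [tuple n] y ->
  exec (compile f (fun _ => 0) 1 2) (input n) (upd (input n) 1 y).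
Proof.
move=> H; apply: (comp_ok H) => //; first by case.
by move=> i; rewrite (tnth_nth 0) /=; case: i => [[]].
Qed.

Lemma main_halt f n : computes f [tuple n] 0 ->
  exists t, iter t (mstep (main_prog f)) (0, input n) = (size (main_prog f), fun _ => 0).
Proof.
move=> /main_comp H.
have ex : exec (main_cmd f) (input n) (fun _ => 0).
  apply: ESeq H _; apply: ESeq (exec_clear _ _) _.
  by apply: exec_eq (ELoop0 _ _) _ => //; rewrite /input; upd_tac.
have [m E] := flat_exec ex [:: JMP 1] [::].
exists (m + 1); rewrite iterD size_main.
have -> : main_prog f = [:: JMP 1] ++ flat (main_cmd f) (size [:: JMP 1]) ++ [::] by rewrite cats0.
exact: E.
Qed.

Lemma mstep_stuck prog c t : size prog <= c.1 -> iter t (mstep prog) c = c.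
Proof.
move=> h; have E : mstep prog c = c by rewrite /mstep /instr_at nth_default //; case: c {h}.
by elim: t => //= t ->.
Qed.

(** Decrement, increment and jump bring the machine back to the same position every three steps with
    register 1 still positive, whereas a position past the end would be permanent. *)
Lemma main_loop f n y : computes f [tuple n] y.+1 ->
  forall t, (iter t (mstep (main_prog f)) (0, input n)).1 < size (main_prog f).
Proof.
move=> /main_comp H.
pose u := JMP 1 :: flat (Seq (compile f (fun _ => 0) 1 2) (clear 0)) 1.
have Ep : main_prog f = u ++ [:: DEC 1 (size u).+1 (size u).+3; INC 1 (size u).+2; JMP (size u)].
  rewrite /u /main_prog /= size_cat !size_flat /= -!catA /=; congr (_ :: _ ++ _).
  by do ![congr cons] => //; rewrite -?catA /=; repeat f_equal; lia.
have ex : exec (Seq (compile f (fun _ => 0) 1 2) (clear 0)) (input n) (upd (upd (input n) 1 y.+1) 0 0).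
  by apply: ESeq H _; apply: exec_clear.
have [m0 E0] := flat_exec ex [:: JMP 1] [:: DEC 1 (size u).+1 (size u).+3; INC 1 (size u).+2; JMP (size u)].
have reach : iter (m0 + 1) (mstep (main_prog f)) (0, input n) = (size u, upd (upd (input n) 1 y.+1) 0 0).
  rewrite iterD Ep -[u]/([:: JMP 1] ++ flat (Seq (compile f (fun _ => 0) 1 2) (clear 0)) (size [:: JMP 1])).
  rewrite -catA; set c1 := iter 1 _ _.
  have -> : c1 = (size [:: JMP 1], input n) by [].
  by rewrite E0 size_cat size_flat.
have cyc st : 0 < st 1 -> exists2 st', 0 < st' 1 & iter 3 (mstep (main_prog f)) (size u, st) = (size u, st').
  case E: (st 1) => [//|v] _; exists (upd (upd st 1 v) 1 v.+1) => //.
  have I0 : instr_at (main_prog f) (size u) = DEC 1 (size u).+1 (size u).+3 by rewrite Ep instr_at_cat.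
  have I1 : instr_at (main_prog f) (size u).+1 = INC 1 (size u).+2.
    by rewrite Ep /instr_at nth_cat ltnNge leqnSn /= subSnn.
  have I2 : instr_at (main_prog f) (size u).+2 = JMP (size u).
    by rewrite Ep /instr_at nth_cat ltnNge (leq_trans (leqnSn _) (leqnSn _)) /= -[_.+2]addn2 addKn.
  by rewrite /= /mstep /= I0 E /= I1 /= I2 /= upd_same.
have inf k : exists2 st', 0 < st' 1 & iter (3 * k + (m0 + 1)) (mstep (main_prog f)) (0, input n) = (size u, st').
  elim: k => [|k [st s1 IH]]; first by exists (upd (upd (input n) 1 y.+1) 0 0).
  have [st' s1' E] := cyc st s1; exists st' => //.
  by rewrite mulnS -addnA iterD IH E.
move=> t; rewrite ltnNge; apply/negP => h.
have [st' _] := inf t; have -> : 3 * t + (m0 + 1) = (2 * t + (m0 + 1)) + t by lia.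
rewrite iterD mstep_stuck // => E; move: h; rewrite E Ep size_cat /=; lia.
Qed.

(** * Windows on the tape of a tag system *)

Section Transducer.
Variables (jump : bool -> nat) (bl : bool -> seq bool).
Hypothesis jump0 : forall l, 0 < jump l.
Local Notation W := (appended bl).
Local Notation tnext := (tnext jump bl).

(** The effect of consuming a piece of tape, separated from what follows it: the offset left over at
    its end and the letters appended meanwhile. *)
Fixpoint tr (o : nat) (u : seq bool) : nat * seq bool :=
  match u, o with
  | [::], _ => (o, [::])
  | _ :: u', o'.+1 => tr o' u'
  | x :: u', 0 => ((tr (jump x).-1 u').1, W x ++ (tr (jump x).-1 u').2)
  end.

Lemma tr_cat o u v : tr o (u ++ v) =
  ((tr (tr o u).1 v).1, (tr o u).2 ++ (tr (tr o u).1 v).2).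
Proof.
elim: u o => [|x u IH] [|o] //=; try by case: (tr _ v).
by rewrite IH /= catA.
Qed.

Lemma tr_drop a o u : a <= size u -> tr (a + o) u = tr o (drop a u).
Proof. by elim: u a => [|x u IH] [|a] //= au; rewrite ?drop0 //= IH. Qed.

Lemma tr_skip o u : size u <= o -> tr o u = (o - size u, [::]).
Proof. by move=> h; rewrite -{1}(subnKC h) tr_drop // drop_size; case: (_ - _). Qed.

Lemma tr_read pos u : pos < size u -> let x := nth false u pos in
  tr pos u = ((tr (pos + jump x) u).1, W x ++ (tr (pos + jump x) u).2).
Proof.
move=> lt x; rewrite -[in LHS](addn0 pos) tr_drop 1?ltnW // (drop_nth false lt) /=.
have -> : pos + jump x = pos.+1 + (jump x).-1 by have := jump0 x; lia.
by rewrite tr_drop.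
Qed.

(** The condition keeps the system from stopping at its last letter: either something follows [u],
    or a production is appended while another letter is still left. *)
Lemma tr_run o u v : v <> [::] \/ o.+1 < size u ->
  iter (size u) tnext (o, u ++ v) = ((tr o u).1, v ++ (tr o u).2).
Proof.
elim: u o v => [|x u IH] o v hv; first by rewrite /= cats0; case: o hv.
have ne : exists y t, u ++ v = y :: t.
  case: u v hv {IH} => [|y u] [|z v] //=; [by case | by exists z, v | by exists y, (u ++ [::]) | by exists y, (u ++ z :: v)].
rewrite [size _]/= iterSr; have [y [t E]] := ne.
have -> : tnext (o, (x :: u) ++ v) =
    if o is o'.+1 then (o', u ++ v) else ((jump x).-1, u ++ (v ++ W x)).
  by rewrite catA /= E; case: o {hv}.
case: o hv => [|o] hv; rewrite IH /= ?catA //.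
  by left; rewrite /appended; case: v {hv E ne IH} => //=; case: (bl x).
Qed.

Lemma tr_bs m o u : W false = [:: false] ->
  (forall k, k < m -> o + k * jump false < size u /\ nth false u (o + k * jump false) = false) ->
  tr o u = ((tr (o + m * jump false) u).1, nseq m false ++ (tr (o + m * jump false) u).2).
Proof.
move=> Wb; elim: m o => [|m IH] o h; first by rewrite mul0n addn0; case: tr.
have [lt E] := h 0 isT; rewrite mul0n addn0 in lt E.
rewrite tr_read // E Wb IH => [|k km].
  by rewrite mulSn addnA.
by rewrite -addnA -mulSn; apply: h.
Qed.

End Transducer.

Section Windows.
Variables (c0 T Smax beta : nat) (F : nat -> nat -> seq nat).
Let A := (T + 2) * c0.
Hypothesis c00 : 0 < c0.
Hypothesis betaA : A * (Smax + 3) < beta.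
Hypothesis F_sorted : forall S rem, sorted leq (F S rem).
Hypothesis F_c0 : forall S rem, all (fun x => x < c0) (F S rem).
Hypothesis F_T : forall S rem, size (F S rem) <= T.
Hypothesis F_S : forall S d rem, size (F (S + d) rem) <= size (F S rem) + d.

(* A window [x_1 <= ... <= x_t] is the word
   b^(x_1) U b^(x_2 - x_1) U ... U b^(A - t c0 - x_t).
   View [U] as an array with rows of length [beta]: reading a b moves one row
   down, and reading a c moves [c0] rows down and [A] columns to the left.  A
   run entering [U] in column [A S - rem] reads exactly [A] rows, and writes
   the window [F S rem]. *)
Definition wjump (l : bool) := if l then c0 * beta - A else beta.
(** A cell knows only its row and column. It takes [rho %/ c0] for the number of c already read,
    which is right up to the last c because number [j] stands in row [y_j + j c0] with [y_j < c0].
    This gives back the entry column, hence [S] by rounding up, and [rem]. The default [c0] of [nth]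
    equals no residue, so it yields a b. *)
Definition isC (rho col : nat) : bool :=
  let j := rho %/ c0 in
  let o := col + A * j in
  let S := (o + A.-1) %/ A in
  nth c0 (F S (A * S - o)) j == rho %% c0.
(** With this length, leaving U after [A] rows and [t] letters c adds [2 A - c0 - A t] to the
    offset: [S] changes by [2 - t], and U is worth [c0] copies of b. *)
Definition Usize := A * beta - (2 * A - c0).
Definition wbl (l : bool) : seq bool :=
  if l then mkseq (fun pos => isC (pos %/ beta) (pos %% beta)) Usize.-1 else [::].
(** A tag production ends with the letter that was read, so the last letter of U is a forced c; the
    runs considered never read it. *)
Definition U := rcons (wbl true) true.

(** [r] counts rows: a b is one row, a U is [c0] rows, and every window has [A] rows in all. The
    empty window is b^A. *)
Fixpoint rawrow r (ys : seq nat) j : seq bool :=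
  if ys is y :: ys' then
    nseq (y + j * c0 - r) false ++ U ++ rawrow (y + j * c0 + c0) ys' j.+1
  else nseq (A - r) false.
Definition raw ys := rawrow 0 ys 0.

Local Notation trw := (tr wjump wbl).

Let A0 : 2 * c0 <= A. Proof. by rewrite /A leq_mul2r leq_addl orbT. Qed.

Lemma Usize_gt : A * (beta - 2) + c0 = Usize /\ A * Smax < beta.
Proof.
rewrite /Usize; move: betaA A0; rewrite mulnDr => h1 h2.
have h3 : 2 * A <= A * beta by rewrite mulnC leq_mul2l; lia.
by split; [rewrite mulnBr; lia | lia].
Qed.

Lemma wjump0 l : 0 < wjump l.
Proof.
case: l => /=; last by lia.
have := betaA; have := A0; rewrite mulnDr => h1 h2.
have : beta <= c0 * beta by rewrite leq_pmull.
lia.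
Qed.

Lemma size_U : size U = Usize.
Proof.
rewrite size_rcons size_mkseq prednK //; have [<- _] := Usize_gt.
by rewrite addn_gt0 c00 orbT.
Qed.

Lemma isCE S rem j d x : rem < A -> x < c0 -> A * j + rem <= A * S ->
  isC ((j + d) * c0 + x) (A * S - rem - A * j) = (nth c0 (F (S + d) rem) (j + d) == x).
Proof.
move=> remA xc le.
have E1 : ((j + d) * c0 + x) %/ c0 = j + d by rewrite divnMDl // divn_small // addn0.
have E2 : ((j + d) * c0 + x) %% c0 = x by rewrite modnMDl modn_small.
rewrite /isC E1 E2.
have -> : A * S - rem - A * j + A * (j + d) = A * (S + d) - rem by rewrite !mulnDr; lia.
have -> : (A * (S + d) - rem + A.-1) %/ A = S + d.
  have -> : A * (S + d) - rem + A.-1 = (S + d) * A + (A.-1 - rem).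
    by rewrite [(S + d) * A]mulnC mulnDr; lia.
  by rewrite divnMDl ?divn_small ?addn0 //; lia.
by have -> : A * (S + d) - (A * (S + d) - rem) = rem by rewrite mulnDr; lia.
Qed.

Lemma pathU S rem rho j : T < S -> S <= Smax -> rem < A ->
  let ys := F S rem in
  j <= size ys -> j * c0 <= rho -> rho <= A ->
  (j < size ys -> rho <= nth 0 ys j + j * c0) ->
  trw (rho * beta + (A * S - rem - A * j)) U =
    (A * S - rem + (2 * A - c0) - A * size ys, rawrow rho (drop j ys) j).
Proof.
move=> TS SS remA ys; have [n] := ubnP (A - rho).
elim: n rho j => // n IH rho j lt js jr rA rj.
have [US AS] := Usize_gt.
have tT : size ys <= T := F_T S rem.
have col : A * S - rem <= A * Smax.
  by apply: leq_trans (leq_subr _ _) _; rewrite leq_mul2l SS orbT.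
have big : A * size ys + A <= A * S - rem + rem.
  rewrite subnK; last by apply: leq_trans (ltnW remA) _; rewrite leq_pmulr; lia.
  by rewrite -mulnSr leq_mul2l; apply/orP; right; lia.
have big' : A * j <= A * size ys by rewrite leq_mul2l js orbT.
have betaA' : A * Smax + 3 * A < beta by move: betaA; rewrite mulnDr; lia.
have A0' := A0.
have yc i : i < size ys -> nth 0 ys i < c0.
  by move=> it; apply: (allP (F_c0 S rem)); apply: mem_nth.
have jc i : i < size ys -> i.+2 * c0 <= A.
  by move=> it; rewrite leq_mul2r; apply/orP; right; lia.
have Ab : A * beta = A * (beta - 2) + 2 * A by rewrite mulnBr [2 * A]mulnC subnK // leq_mul2l; lia.
have [rhoA|rhoA] := eqVneq rho A.
  have jt : j = size ys.
    apply/eqP; rewrite eqn_leq js leqNgt; apply/negP => jt.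
    by have := rj jt; have := yc _ jt; have := jc _ jt; rewrite !mulSn; lia.
  rewrite jt drop_size rhoA /= subnn tr_skip ?size_U; last by lia.
  by congr pair; lia.
have {rhoA}rA : rho < A by lia.
have rb : rho * beta + beta <= A * beta by rewrite -mulSnr leq_mul2r rA orbT.
set pos := rho * beta + _.
have posU : pos < Usize.-1 by rewrite /pos; lia.
have cb : A * S - rem - A * j < beta by lia.
have Epos : nth false U pos = isC rho (A * S - rem - A * j).
  rewrite /U nth_rcons size_mkseq posU nth_mkseq // /pos divnMDl; last by lia.
  by rewrite divn_small // addn0 modnMDl modn_small.
rewrite tr_read; [|exact: wjump0|by rewrite size_U; lia].
rewrite Epos.
have le : A * j + rem <= A * S by lia.
have [jt|jt] := ltnP j (size ys).
  have rle := rj jt; have yj := yc _ jt; have jcj := jc _ jt.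
  rewrite (drop_nth 0 jt) /=.
  have Ex : rho = (j + 0) * c0 + (rho - j * c0) by rewrite addn0; lia.
  have -> : isC rho (A * S - rem - A * j) = (rho == nth 0 ys j + j * c0).
    rewrite Ex isCE //; last by lia.
    rewrite -Ex !addn0 -/ys (set_nth_default 0) //.
    by apply/eqP/eqP; lia.
  case: eqP => [Er|ne].
    have -> : pos + wjump true = (rho + c0) * beta + (A * S - rem - A * j.+1).
      rewrite /pos /wjump mulnDl mulnSr.
      have : beta <= c0 * beta by rewrite leq_pmull.
      have : A * j + A <= A * size ys by rewrite -mulnSr leq_mul2l jt orbT.
      lia.
    rewrite IH //=.
    - by rewrite -Er subnn.
    - by lia.
    - by rewrite mulSn; lia.
    - by move: jcj; rewrite !mulSn; lia.
    move=> jt'; rewrite mulSn Er.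
    suff : nth 0 ys j <= nth 0 ys j.+1 by lia.
    have := F_sorted S rem; rewrite -/ys => /(sortedP 0)/(_ j jt').
    by [].
  have -> : pos + wjump false = rho.+1 * beta + (A * S - rem - A * j) by rewrite /pos /= mulSn; lia.
  rewrite IH //=; try lia.
  rewrite (drop_nth 0 jt) /=.
  by have -> : nth 0 ys j + j * c0 - rho = (nth 0 ys j + j * c0 - rho.+1).+1 by lia.
have {jt}jt : j = size ys by lia.
(* All outputs are written but rows are left. The guess [rho %/ c0] now exceeds the number of c read
   by some [d], so the cell consults [F] at [S + d] and index [j + d]; hypothesis [F_S] puts this
   index out of range, and the cell is a b. *)
have Ej : j <= rho %/ c0 by rewrite leq_divRL.
have -> : isC rho (A * S - rem - A * j) = false.
  rewrite {1}(divn_eq rho c0) -(subnKC Ej) isCE ?ltn_pmod //.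
  rewrite nth_default; last by rewrite jt; apply: F_S.
  by apply/negbTE; rewrite neq_ltn ltn_pmod // orbT.
have -> : pos + wjump false = rho.+1 * beta + (A * S - rem - A * j) by rewrite /pos /= mulSn; lia.
rewrite IH //=; try lia.
rewrite jt drop_size /=.
by have -> : A - rho = (A - rho.+1).+1 by lia.
Qed.

(* Reading a window at offset [A S] ends at the offset [A S'], where [S' + 1] is
   the first component of [wread S 0 xs]. *)
Fixpoint wread S i (xs : seq nat) : nat * seq (seq nat) :=
  if xs is x :: xs' then
    let o := F S (i * c0 + x) in
    let r := wread (S + 2 - size o) i.+1 xs' in (r.1, o :: r.2)
  else (S, [::]).

Fixpoint wok S i (xs : seq nat) : bool :=
  if xs is x :: xs' then
    (T < S <= Smax) && wok (S + 2 - size (F S (i * c0 + x))) i.+1 xs'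
  else 0 < S.

Definition wf_window (xs : seq nat) :=
  [&& sorted leq xs, all (fun x => x < c0) xs & size xs <= T].

(** Invariant: in row [r] of the window the offset is [A S - r]. The copies of b are all skipped
    because [A S] is large, and a U replaces [S] by [S + 2 - t]. The last row is [A], which leaves
    the offset [A (S - 1)]. *)
Lemma window_read_aux S i r xs : wok S i xs -> r <= A ->
  sorted leq xs -> all (fun x => x < c0) xs -> i + size xs <= T ->
  (if xs is x :: _ then r <= x + i * c0 else true) ->
  trw (A * S - r) (rawrow r xs i) =
    (A * (wread S i xs).1.-1, flatten (map raw (wread S i xs).2)).
Proof.
elim: xs S i r => [|x xs IH] S i r.
  move=> /= S1 rA _ _ _ _; rewrite tr_skip size_nseq.
    by congr pair; rewrite -subn1 mulnBr muln1; lia.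
  by rewrite leq_sub2r // leq_pmulr.
move=> /= /andP[/andP[TS SS] ok] rA srt /andP[xc xsc] szT rx.
have Ai : (i.+2) * c0 <= A by rewrite leq_mul2r; apply/orP; right; lia.
have remA : i * c0 + x < A by move: Ai; rewrite !mulSn; lia.
have AS : A <= A * S by rewrite leq_pmulr; lia.
have Esk : trw (A * S - r) (nseq (x + i * c0 - r) false) =
    (A * S - r - (x + i * c0 - r), [::]).
  by rewrite tr_skip size_nseq //; lia.
rewrite tr_cat Esk.
have -> : A * S - r - (x + i * c0 - r) = 0 * beta + (A * S - (i * c0 + x) - A * 0) by lia.
set o := F S _.
have szo : A * size o <= A * T by rewrite leq_mul2l F_T orbT.
have AT : A * T + A <= A * S by rewrite -mulnSr leq_mul2l TS orbT.
have EU : trw (0 * beta + (A * S - (i * c0 + x) - A * 0)) U =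
    (A * (S + 2 - size o) - (x + i * c0 + c0), raw o).
  rewrite pathU //.
  by rewrite drop0 -/o; congr pair; rewrite mulnBr mulnDr; have := A0; lia.
cbn [fst snd]; rewrite tr_cat EU; cbn [fst snd]; rewrite cat0s.
rewrite IH //=.
- by move: Ai; rewrite !mulSn; lia.
- exact: path_sorted srt.
- by lia.
by case: xs srt {IH ok xsc szT} => //= y xs /andP[xy _]; rewrite mulSn; lia.
Qed.

Lemma window_read S xs : wok S 0 xs -> wf_window xs ->
  trw (A * S) (raw xs) = (A * (wread S 0 xs).1.-1, flatten (map raw (wread S 0 xs).2)).
Proof.
move=> ok /and3P[srt xc szT]; rewrite -[A * S]subn0 (window_read_aux ok) //.
by case: xs {ok srt xc szT}.
Qed.

Fixpoint tread S (ws : seq (seq nat)) : nat * seq (seq nat) :=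
  if ws is w :: ws' then
    let r := wread S 0 w in let r' := tread r.1.-1 ws' in (r'.1, r.2 ++ r'.2)
  else (S, [::]).

Fixpoint tok_ok S (ws : seq (seq nat)) : bool :=
  if ws is w :: ws' then
    [&& wok S 0 w, wf_window w & tok_ok (wread S 0 w).1.-1 ws']
  else true.

Definition tape (ws : seq (seq nat)) : seq bool := flatten (map raw ws).

Lemma tape_read S ws : tok_ok S ws ->
  trw (A * S) (tape ws) = (A * (tread S ws).1, tape (tread S ws).2).
Proof.
elim: ws S => [|w ws IH] S //=.
case/and3P => ok wf oks; rewrite /tape /= tr_cat window_read // [_.1]/= -/(tape ws) IH //=.
by rewrite /tape map_cat flatten_cat.
Qed.

Lemma tread_cat S u v : tread S (u ++ v) =
  ((tread (tread S u).1 v).1, (tread S u).2 ++ (tread (tread S u).1 v).2).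
Proof. by elim: u S => [|w u IH] S /=; [case: tread | rewrite IH /= catA]. Qed.

Lemma tok_ok_cat S u v : tok_ok S (u ++ v) = tok_ok S u && tok_ok (tread S u).1 v.
Proof. by elim: u S => [|w u IH] S //=; rewrite IH !andbA. Qed.

Lemma size_raw S xs : S <= Smax -> xs != [::] -> (A * S).+1 < size (raw xs).
Proof.
case: xs => // x xs SS _; rewrite /raw /= !size_cat size_U.
have [US AS] := Usize_gt; move: betaA; have := A0; rewrite mulnDr => h1 h2.
have : A * S <= A * Smax by rewrite leq_mul2l SS orbT.
have : 2 * (beta - 2) <= A * (beta - 2) by rewrite leq_mul2r; apply/orP; right; lia.
lia.
Qed.

Lemma tape_run S ws : tok_ok S ws -> S <= Smax -> has (fun w => w != [::]) ws ->
  iter (size (tape ws)) (tnext wjump wbl) (A * S, tape ws) =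
    (A * (tread S ws).1, tape (tread S ws).2).
Proof.
move=> ok SS hw; rewrite -[X in iter _ _ (_, X)]cats0 tr_run; last first.
  right; elim: ws hw {ok} => //= w ws IH /orP[w0|/IH le]; rewrite /tape /= size_cat.
    by apply: leq_trans (size_raw SS w0) (leq_addr _ _).
  by apply: leq_trans le (leq_addl _ _).
by rewrite cat0s tape_read.
Qed.

End Windows.

(** * Simulating counter machines by tag systems *)

Section Simulation.
Variables (prog : seq instr) (R : nat).
Let qn := size prog.
Hypothesis wfp : all (wf_instr qn R) prog.

Definition xh q := 2 * q.
Definition xh1 q := (2 * q).+1.
Definition xc r := 2 * qn + 2 + r.
Definition junk := 2 * qn + 2 + R.
Definition wc0 := (2 * qn + 3 + R).
Definition wT := 2 * R + 3.
(** A decrement lowers [S] to as little as [S0 - 2 R], which must stay above [wT] with room to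
    spare. [S0] is even, so all the values [S0 - 2 (r + 1)] that delete a cell are even. *)
Definition S0 := 8 * R + 20.
Definition wSmax := S0 + 6 * R + 10.
Definition wA := (wT + 2) * wc0.
Definition wbeta := (wA * (wSmax + 3)).+1.

(* The payloads [xh q] and [xh1 q] mark the state, [xc r] a unit of register
   [r].  Tests for zero are done by [S]: a pass started at [S0 - 2 (r + 1)]
   deletes the first [xc r], which changes the parity of [S] for the rest. *)
Definition Fx S x : seq nat :=
  if x < 2 * qn + 2 then
    let q := x %/ 2 in
    if odd x then
      match instr_at prog q with
      | INC _ q' => [:: xh q']
      | DEC r q1 q0 => [:: xh (if S == S0 - 2 * r.+1 then q0 else q1)]
      | JMP _ => [::]
      end
    else if q == qn then [::] else
      match instr_at prog q with
      | INC r _ => [:: xh1 q; xc r]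
      | DEC r _ _ => xh1 q :: nseq (2 * r.+1) junk
      | JMP q' => [:: xh q']
      end
  else if (x == junk) || (S == S0 - 2 * (x - (2 * qn + 2)).+1) then [::]
  else [:: x].
Definition F S rem := Fx S (rem %% wc0).

Lemma wf_at q : q < qn -> wf_instr qn R (instr_at prog q).
Proof. by move=> lt; apply: (all_nthP _ wfp). Qed.

Lemma div2x x : x < 2 * qn + 2 -> ~~ odd x -> x %/ 2 != qn -> x %/ 2 < qn.
Proof. lia. Qed.

Lemma wc0_gt0 : 0 < wc0. Proof. by rewrite /wc0; lia. Qed.
Lemma wA_gt : 2 * wc0 <= wA. Proof. by rewrite /wA leq_mul2r leq_addl orbT. Qed.
Lemma wbetaP : (wT + 2) * wc0 * (wSmax + 3) < wbeta.
Proof. by rewrite ltnS. Qed.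

Lemma F_case (P : seq nat -> Prop) S x : x < wc0 ->
  P [::] -> (forall y, y < wc0 -> P [:: y]) ->
  (forall q r, q < qn -> r < R -> P [:: xh1 q; xc r]) ->
  (forall q r, q < qn -> r < R -> P (xh1 q :: nseq (2 * r.+1) junk)) -> P (Fx S x).
Proof.
move=> xw P0 P1 P2 P3; rewrite /Fx; case: ltnP => [lt|ge]; last first.
  by case: ifP => _; [exact: P0 | apply: P1].
case: ifP => [od|/negbT ev].
  have [q_lt|q_ge] := ltnP (x %/ 2) qn; last by rewrite /instr_at nth_default.
  have := wf_at q_lt; case: instr_at => [r q'|r q1 q0|q'] //=.
    by move=> /andP[_ h]; apply: P1; rewrite /xh /wc0; lia.
  by move=> /and3P[_ h1 h2]; apply: P1; rewrite /xh /wc0; case: ifP; lia.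
case: eqP => // /eqP ne; have q_lt := div2x lt ev ne.
have := wf_at q_lt; case: instr_at => [r q'|r q1 q0|q'] //=.
- by case/andP => *; apply: P2.
- by case/and3P => *; apply: P3.
by move=> h; apply: P1; rewrite /xh /wc0; lia.
Qed.

Lemma F_sorted S rem : sorted leq (F S rem).
Proof.
apply: (F_case (P := fun s => sorted leq s)) => //; first by rewrite ltn_pmod ?wc0_gt0.
  by move=> q r qq rR; rewrite /= andbT /xh1 /xc; lia.
move=> q r qq rR; move: (2 * r.+1) => [|m] //=; apply/andP; split; first by rewrite /xh1 /junk; lia.
by elim: m => //= m ->; rewrite leqnn.
Qed.

Lemma F_c0 S rem : all (fun x => x < wc0) (F S rem).
Proof.
apply: (F_case (P := fun s => all (fun x => x < wc0) s)) => //; first by rewrite ltn_pmod ?wc0_gt0.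
- by move=> y yw /=; rewrite yw.
- by move=> q r qq rR; rewrite /= /xh1 /xc /wc0; lia.
by move=> q r qq rR; rewrite /= all_nseq /xh1 /junk /wc0; lia.
Qed.

Lemma F_T S rem : size (F S rem) <= wT.
Proof.
apply: (F_case (P := fun s => size s <= wT)) => //; first by rewrite ltn_pmod ?wc0_gt0.
- by move=> y _; rewrite /= /wT; lia.
- by move=> q r _ _; rewrite /= /wT; lia.
by move=> q r _ rR; rewrite /= size_nseq /wT; lia.
Qed.

(** [S] only decides whether a cell survives or which state a head moves to, so it changes the size
    of an output by at most one. *)
Lemma F_S S d rem : size (F (S + d) rem) <= size (F S rem) + d.
Proof.
case: d => [|d]; first by rewrite !addn0.
rewrite /F /Fx; case: ltnP => _.
  case: odd; first by case: instr_at => //= *; lia.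
  by case: eqP => //= _; lia.
by do 2!case: ifP => _ /=; lia.
Qed.

Local Notation wjump := (wjump wc0 wT wbeta).
Local Notation wbl := (wbl wc0 wT wbeta F).
Local Notation tnextw := (tnext wjump wbl).
Local Notation raw := (raw wc0 wT wbeta F).
Local Notation tape := (tape wc0 wT wbeta F).
Local Notation tread := (tread wc0 F).
Local Notation wread := (wread wc0 F).
Local Notation wok := (wok wc0 wT wSmax F).
Local Notation tok_ok := (tok_ok wc0 wT wSmax F).

Lemma FE S i x : x < wc0 -> F S (i * wc0 + x) = Fx S x.
Proof. by move=> h; rewrite /F modnMDl modn_small. Qed.

Lemma Fx_cell S r : r < R -> Fx S (xc r) = if S == S0 - 2 * r.+1 then [::] else [:: xc r].
Proof.
move=> rR; rewrite /Fx /xc /junk ltnNge leq_addr /= addKn.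
by rewrite (_ : (_ + r == _) = false) //; apply/eqP; lia.
Qed.

Lemma Fx_junk S : Fx S junk = [::].
Proof. by rewrite /Fx /junk ltnNge leq_addr /= eqxx. Qed.

Lemma Fx_head S q : q < qn -> Fx S (xh q) =
  match instr_at prog q with
  | INC r _ => [:: xh1 q; xc r]
  | DEC r _ _ => xh1 q :: nseq (2 * r.+1) junk
  | JMP q' => [:: xh q']
  end.
Proof.
move=> lt; rewrite /Fx /xh.
have -> : 2 * q < 2 * qn + 2 by lia.
have -> : odd (2 * q) = false by rewrite oddM.
by rewrite mulKn // (ltn_eqF lt).
Qed.

Lemma Fx_head1 S q : q < qn -> Fx S (xh1 q) =
  match instr_at prog q with
  | INC _ q' => [:: xh q']
  | DEC r q1 q0 => [:: xh (if S == S0 - 2 * r.+1 then q0 else q1)]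
  | JMP _ => [::]
  end.
Proof.
move=> lt; rewrite /Fx /xh1.
have -> : (2 * q).+1 < 2 * qn + 2 by lia.
have -> : odd (2 * q).+1 by rewrite /= oddM.
by have -> : (2 * q).+1 %/ 2 = q by lia.
Qed.

Lemma Fx_halt S : Fx S (xh qn) = [::].
Proof.
rewrite /Fx /xh; have -> : 2 * qn < 2 * qn + 2 by lia.
have -> : odd (2 * qn) = false by rewrite oddM.
by rewrite mulKn // eqxx.
Qed.

Definition cells (ws : seq nat) : seq (seq nat) := [seq [:: xc r] | r <- ws].

Lemma xc_lt r : r < R -> xc r < wc0. Proof. by rewrite /xc /wc0; lia. Qed.
Lemma xh_lt q : q <= qn -> xh q < wc0. Proof. by rewrite /xh /wc0; lia. Qed.
Lemma xh1_lt q : q < qn -> xh1 q < wc0. Proof. by rewrite /xh1 /wc0; lia. Qed.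

Lemma wread1 S x : x < wc0 -> wread S 0 [:: x] = (S + 2 - size (Fx S x), [:: Fx S x]).
Proof. by move=> h; rewrite /= FE. Qed.

Lemma wf1 x : x < wc0 -> wf_window wc0 wT [:: x].
Proof. by move=> h; rewrite /wf_window /= h /wT; lia. Qed.

Lemma size_FxT S x : x < wc0 -> size (Fx S x) <= wT.
Proof. by move=> h; have := F_T S x; rewrite /F modn_small. Qed.

Lemma wok1 S x : x < wc0 -> wok S 0 [:: x] = (wT < S <= wSmax).
Proof.
move=> h; rewrite /= FE //; apply/idP/idP => [/andP[] //|h1]; rewrite h1 /=.
by have := size_FxT S h; lia.
Qed.

Lemma wread_cons S i x xs : wread S i (x :: xs) =
  ((wread (S + 2 - size (F S (i * wc0 + x))) i.+1 xs).1,
   F S (i * wc0 + x) :: (wread (S + 2 - size (F S (i * wc0 + x))) i.+1 xs).2).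
Proof. by []. Qed.

Lemma wok_cons S i x xs : wok S i (x :: xs) =
  (wT < S <= wSmax) && wok (S + 2 - size (F S (i * wc0 + x))) i.+1 xs.
Proof. by []. Qed.

Lemma tread_cons S w t : tread S (w :: t) =
  ((tread (wread S 0 w).1.-1 t).1, (wread S 0 w).2 ++ (tread (wread S 0 w).1.-1 t).2).
Proof. by []. Qed.

Lemma tok_cons S w t : tok_ok S (w :: t) =
  [&& wok S 0 w, wf_window wc0 wT w & tok_ok (wread S 0 w).1.-1 t].
Proof. by []. Qed.

Lemma tread_nil S j : tread S (nseq j [::]) = (S - j, [::]).
Proof. by elim: j S => [|j IH] S; [rewrite subn0 | rewrite tread_cons IH /= -subn1 -subnDA]. Qed.

Lemma tok_nil S j : j < S -> tok_ok S (nseq j [::]).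
Proof. by elim: j S => [|j IH] S //= lt; rewrite IH /=; lia. Qed.

Lemma tread_cells S ws : all (fun r => r < R) ws -> (forall r, r \in ws -> S != S0 - 2 * r.+1) ->
  tread S (cells ws) = (S, cells ws).
Proof.
elim: ws => //= r ws IH /andP[rR wR] h; rewrite FE ?xc_lt // Fx_cell //.
rewrite (negbTE (h _ (mem_head _ _))) /=.
have -> : (S + 2 - 1).-1 = S by lia.
by rewrite IH // => r' r'w; apply: h; rewrite inE r'w orbT.
Qed.

Lemma tok_cells S ws : all (fun r => r < R) ws -> (forall r, r \in ws -> S != S0 - 2 * r.+1) ->
  wT < S <= wSmax -> tok_ok S (cells ws).
Proof.
move=> + + SS; elim: ws => //= r ws IH /andP[rR wR] h.
rewrite -/(wok S 0 [:: xc r]) ?wok1 ?xc_lt // SS wf1 ?xc_lt //=.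
rewrite FE ?xc_lt // Fx_cell // (negbTE (h _ (mem_head _ _))) /=.
have -> : (S + 2 - 1).-1 = S by lia.
by apply: IH => // r' r'w; apply: h; rewrite inE r'w orbT.
Qed.

Definition conf S ws := (wA * S, tape ws).

Definition pass (c c' : tconfig) := exists m, iter m.+1 tnextw c = c'.

Lemma pass_trans c1 c2 c3 : pass c1 c2 -> pass c2 c3 -> pass c1 c3.
Proof.
move=> [m1 E1] [m2 E2]; exists (m2.+1 + m1).
by rewrite -addnS iterD E1.
Qed.

Lemma pass_conf S ws : tok_ok S ws -> S <= wSmax -> has (fun w => w != [::]) ws ->
  pass (conf S ws) (conf (tread S ws).1 (tread S ws).2).
Proof.
move=> ok SS hw.
have := tape_run wc0_gt0 wbetaP F_sorted F_c0 F_T F_S ok SS hw.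
case E: (size (tape ws)) => [|m]; last by exists m.
have : has (fun w => w != [::]) ws -> 0 < size (tape ws).
  elim: (ws) => //= w ws' IH /orP[|/IH]; rewrite /tape /= size_cat; last by lia.
  by case: w => //= x w _; rewrite !size_cat /U size_rcons; lia.
by move/(_ hw); rewrite E.
Qed.

(** The head changes [S] by [1 - size o] and each empty window lowers it by one. By the size of its
    output, the head thus chooses the value of [S] at which the rest of the tape is first read. *)
Lemma head_pass S q j t o : q <= qn -> o = Fx S (xh q) -> j <= 2 * R ->
  wT + 4 * R + 4 < S -> S <= wSmax ->
  tok_ok (S + 1 - size o - j) t ->
  pass (conf S ([:: xh q] :: nseq j [::] ++ t))
    (conf (tread (S + 1 - size o - j) t).1 (o :: (tread (S + 1 - size o - j) t).2)).
Proof.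
move=> qle Eo jR SL SS ok.
have szo : size o <= wT by rewrite Eo size_FxT // xh_lt.
have Er : (wread S 0 [:: xh q]) = (S + 2 - size o, [:: o]) by rewrite wread1 ?xh_lt // -Eo.
have ES : (S + 2 - size o).-1 = S + 1 - size o by lia.
have := @pass_conf S ([:: xh q] :: nseq j [::] ++ t).
rewrite tread_cons Er; cbn [fst snd]; rewrite ES tread_cat tread_nil.
move=> H; apply: H => //.
rewrite tok_cons wok1 ?xh_lt // wf1 ?xh_lt // Er; cbn [fst snd]; rewrite ES tok_ok_cat tread_nil ok andbT.
by rewrite tok_nil ?SS; lia.
Qed.

(** The [j] empty windows are remnants of a preceding decrement; starting at [S0 + j] compensates
    for them. *)
Definition enc q j ws := conf (S0 + j) ([:: xh q] :: nseq j [::] ++ cells ws).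

Definition encodes (c : nat * state) (tc : tconfig) := exists j ws,
  [/\ tc = enc c.1 j ws, c.1 <= qn, j <= 2 * R, all (fun r => r < R) ws &
      forall r, count_mem r ws = c.2 r].

Lemma sim_jmp q q' j ws : q < qn -> instr_at prog q = JMP q' -> j <= 2 * R ->
  all (fun r => r < R) ws -> pass (enc q j ws) (enc q' 0 ws).
Proof.
move=> lt Ei jR wR; have := wf_at lt; rewrite Ei /= => q'n.
have := @head_pass (S0 + j) q j (cells ws) _ (ltnW lt) erefl jR.
rewrite Fx_head // Ei /= addnK addnK.
rewrite tread_cells //; last by move=> r /(allP wR); rewrite /S0; lia.
rewrite /enc addn0; apply; [rewrite /wT /S0; lia | rewrite /wSmax; lia | ].
by apply: tok_cells => //; [move=> r /(allP wR) | ]; rewrite /wT /wSmax /S0; lia.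
Qed.

(** A head output of size two lowers [S] to [S0 - 1], which is odd and so deletes no cell. The
    second pass splits the two payloads into separate windows and raises [S] back to [S0]. *)
Lemma sim_inc q r q' j ws : q < qn -> instr_at prog q = INC r q' -> j <= 2 * R ->
  all (fun r => r < R) ws -> pass (enc q j ws) (enc q' 0 (r :: ws)).
Proof.
move=> lt Ei jR wR; have := wf_at lt; rewrite Ei /= => /andP[rR q'n].
have := @head_pass (S0 + j) q j (cells ws) _ (ltnW lt) erefl jR.
rewrite Fx_head // Ei /=.
have -> : S0 + j + 1 - 2 - j = S0 - 1 by rewrite /S0; lia.
rewrite tread_cells //; last by move=> r' /(allP wR); rewrite /S0; lia.
move=> H; apply: pass_trans (H _ _ _) _; [rewrite /wT /S0; lia | rewrite /wSmax; lia | | ].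
  by apply: tok_cells => //; [move=> r' /(allP wR) | ]; rewrite /wT /wSmax /S0; lia.
have Ew : wread (S0 - 1) 0 [:: xh1 q; xc r] = (S0 + 1, [:: [:: xh q']; [:: xc r]]).
  rewrite /= !FE ?xh1_lt ?xc_lt // Fx_head1 // Ei /=.
  have -> : S0 - 1 + 2 - 1 = S0 by rewrite /S0; lia.
  rewrite Fx_cell // (_ : (_ == _) = false) /=; last by apply/eqP; rewrite /S0; lia.
  by congr pair; lia.
have Et : tread (S0 - 1) ([:: xh1 q; xc r] :: cells ws) = (S0, [:: xh q'] :: cells (r :: ws)).
  rewrite tread_cons Ew; cbn [fst snd]; rewrite addn1 [_.+1.-1]/= tread_cells //.
  by move=> r' /(allP wR); rewrite /S0; lia.
have := @pass_conf (S0 - 1) ([:: xh1 q; xc r] :: cells ws).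
rewrite Et /enc addn0; apply => //; last by rewrite /wSmax; lia.
rewrite tok_cons Ew; cbn [fst snd]; rewrite addn1 [_.+1.-1]/=.
rewrite tok_cells //; [|by move=> r' /(allP wR); rewrite /S0; lia|by rewrite /wT /wSmax /S0; lia].
rewrite [wok _ _ _]/= !FE ?xh1_lt ?xc_lt // Fx_head1 // Ei /=.
have -> : S0 - 1 + 2 - 1 = S0 by rewrite /S0; lia.
rewrite /wf_window /= xh1_lt // xc_lt // Fx_cell //.
by rewrite /xh1 /xc /wT /wSmax /S0; case: ifP => _ /=; lia.
Qed.

Lemma wread_junk S i m : wread S i (nseq m junk) = (S + 2 * m, nseq m [::]).
Proof.
elim: m S i => [|m IH] S i; first by rewrite addn0.
have jw : junk < wc0 by rewrite /junk /wc0; lia.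
have -> : S + 2 * m.+1 = S + 2 - 0 + 2 * m by lia.
by rewrite [LHS]/= FE // Fx_junk IH.
Qed.

Lemma wok_junk S i m : wT < S -> S + 2 * m <= wSmax -> wok S i (nseq m junk).
Proof.
elim: m S i => [|m IH] S i lt le; first by rewrite /=; lia.
have jw : junk < wc0 by rewrite /junk /wc0; lia.
rewrite /= FE // Fx_junk IH ?subn0; [by rewrite lt; lia | by lia | by lia].
Qed.

(** In the second pass of a decrement [S] still tells whether a cell was deleted, and this selects
    the next state. Each junk payload leaves an empty window and adds 2 to [S]: a deficit of
    [2 (r + 1)] becomes an excess of the same size, matched by as many empty windows. *)
Lemma dec_pass2 S q r t q1 q0 : q < qn -> instr_at prog q = DEC r q1 q0 -> r < R ->
  S0 - 2 * r.+1 <= S -> S <= S0 ->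
  tok_ok (S + 4 * r.+1) t ->
  pass (conf S ((xh1 q :: nseq (2 * r.+1) junk) :: t))
    (conf (tread (S + 4 * r.+1) t).1
      ([:: xh (if S == S0 - 2 * r.+1 then q0 else q1)] :: nseq (2 * r.+1) [::] ++
        (tread (S + 4 * r.+1) t).2)).
Proof.
move=> lt Ei rR SL SU ok.
have Ew : wread S 0 (xh1 q :: nseq (2 * r.+1) junk) =
   (S + 1 + 4 * r.+1, [:: xh (if S == S0 - 2 * r.+1 then q0 else q1)] :: nseq (2 * r.+1) [::]).
  rewrite wread_cons FE ?xh1_lt // Fx_head1 // Ei wread_junk; cbn [fst snd size].
  by congr pair; lia.
have := @pass_conf S ((xh1 q :: nseq (2 * r.+1) junk) :: t).
have ES : (S + 1 + 4 * r.+1).-1 = S + 4 * r.+1 by lia.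
rewrite tread_cons Ew; cbn [fst snd]; rewrite ES => H; apply: H => //.
  rewrite tok_cons Ew; cbn [fst snd]; rewrite ES ok andbT; apply/andP; split.
    rewrite wok_cons FE ?xh1_lt // Fx_head1 // Ei; cbn [size].
    by rewrite wok_junk; move: SL SU; rewrite /wT /wSmax /S0; lia.
  rewrite /wf_window; have := F_sorted 0 (xh q); have := F_c0 0 (xh q); have := F_T 0 (xh q).
  by rewrite /F modn_small ?xh_lt ?(ltnW lt) // Fx_head // Ei => -> -> ->.
by rewrite /wSmax; lia.
Qed.

Lemma first_occ (r : nat) ws : r \in ws -> exists u v, ws = u ++ r :: v /\ r \notin u.
Proof.
elim: ws => //= x ws IH; rewrite inE; have [->|ne] := eqVneq r x; first by exists [::], ws.
by move=> /= /IH [u [v [-> ru]]]; exists (x :: u), v; rewrite inE (negbTE ne).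
Qed.

Lemma cells_cat u v : cells (u ++ v) = cells u ++ cells v. Proof. exact: map_cat. Qed.

Lemma sim_dec0 q r q1 q0 j ws : q < qn -> instr_at prog q = DEC r q1 q0 -> j <= 2 * R ->
  all (fun r => r < R) ws -> r \notin ws -> pass (enc q j ws) (enc q0 (2 * r.+1) ws).
Proof.
move=> lt Ei jR wR rw; have := wf_at lt; rewrite Ei /= => /and3P[rR q1n q0n].
have ne1 r' : r' \in ws -> S0 - 2 * r.+1 != S0 - 2 * r'.+1.
  move=> r'w; have := allP wR _ r'w; have : r != r' by apply: contraNneq rw => ->.
  by rewrite /S0; lia.
have ne2 r' : r' \in ws -> S0 + 2 * r.+1 != S0 - 2 * r'.+1 by move=> _; lia.
have := @head_pass (S0 + j) q j (cells ws) _ (ltnW lt) erefl jR.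
rewrite Fx_head // Ei /= size_nseq.
have -> : S0 + j + 1 - (2 * r.+1).+1 - j = S0 - 2 * r.+1 by rewrite /S0; lia.
rewrite tread_cells // => H; apply: pass_trans (H _ _ _) _; [rewrite /wT /S0; lia | rewrite /wSmax; lia | | ].
  by apply: tok_cells => //; rewrite /wT /wSmax /S0; lia.
have := @dec_pass2 (S0 - 2 * r.+1) q r (cells ws) q1 q0 lt Ei rR (leqnn _) (leq_subr _ _).
have -> : S0 - 2 * r.+1 + 4 * r.+1 = S0 + 2 * r.+1 by rewrite /S0; lia.
rewrite tread_cells // eqxx; apply; apply: tok_cells => //; rewrite /wT /wSmax /S0; lia.
Qed.

(** Deleting the first [xc r] raises [S] to an odd value, so the later cells are kept and the second
    pass sees the success. The empty window left in place of the cell absorbs the surplus of one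
    during that pass. *)
Lemma sim_dec1 q r q1 q0 j u v : q < qn -> instr_at prog q = DEC r q1 q0 -> j <= 2 * R ->
  all (fun r => r < R) (u ++ r :: v) -> r \notin u ->
  pass (enc q j (u ++ r :: v)) (enc q1 (2 * r.+1) (u ++ v)).
Proof.
move=> lt Ei jR; rewrite all_cat /= => /and3P[uR _ vR] ru.
have := wf_at lt; rewrite Ei /= => /and3P[rR q1n q0n].
have Su : forall r', r' \in u -> S0 - 2 * r.+1 != S0 - 2 * r'.+1.
  move=> r' r'u; have := allP uR _ r'u; have : r != r' by apply: contraNneq ru => ->.
  by rewrite /S0; lia.
have Sv : forall r', r' \in v -> S0 - 2 * r.+1 + 1 != S0 - 2 * r'.+1.
  by move=> r' /(allP vR); rewrite /S0; lia.
have Tu : forall r', r' \in u -> S0 + 2 * r.+1 + 1 != S0 - 2 * r'.+1 by move=> r' _; lia.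
have Tv : forall r', r' \in v -> S0 + 2 * r.+1 != S0 - 2 * r'.+1 by move=> r' _; lia.
have W1 : wread (S0 - 2 * r.+1) 0 [:: xc r] = (S0 - 2 * r.+1 + 2, [:: [::]]).
  by rewrite wread1 ?xc_lt // Fx_cell // eqxx /= subn0.
have := @head_pass (S0 + j) q j (cells (u ++ r :: v)) _ (ltnW lt) erefl jR.
rewrite Fx_head // Ei [size _]/= size_nseq.
have -> : S0 + j + 1 - (2 * r.+1).+1 - j = S0 - 2 * r.+1 by rewrite /S0; lia.
have ES : (S0 - 2 * r.+1 + 2).-1 = S0 - 2 * r.+1 + 1 by lia.
rewrite cells_cat -[cells (r :: v)]/([:: xc r] :: cells v).
rewrite tread_cat tread_cells //; cbn [fst snd]; rewrite tread_cons W1.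
cbn [fst snd]; rewrite ES tread_cells //; cbn [fst snd].
rewrite /enc cells_cat -[cells (r :: v)]/([:: xc r] :: cells v).
move=> H; apply: pass_trans (H _ _ _) _; [rewrite /wT /S0; lia | rewrite /wSmax; lia | | ].
  rewrite tok_ok_cat tread_cells //; cbn [fst snd]; rewrite tok_cons W1; cbn [fst snd]; rewrite ES.
  rewrite wok1 ?xc_lt // wf1 ?xc_lt // !tok_cells //; rewrite /wT /wSmax /S0; lia.
have := @dec_pass2 (S0 - 2 * r.+1 + 1) q r (cells u ++ [::] :: cells v) q1 q0 lt Ei rR (leq_addr _ _).
have -> : S0 - 2 * r.+1 + 1 + 4 * r.+1 = S0 + 2 * r.+1 + 1 by rewrite /S0; lia.
rewrite tread_cat tread_cells //; cbn [fst snd]; rewrite tread_cons [wread _ _ [::]]/=.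
have EP : (S0 + 2 * r.+1 + 1).-1 = S0 + 2 * r.+1 by lia.
cbn [fst snd]; rewrite EP tread_cells //.
cbn [fst snd]; rewrite cat0s (_ : (_ == _) = false); last by apply/eqP; rewrite /S0; lia.
rewrite -[cells u ++ cells v]cells_cat => H2; apply: H2; first by rewrite /S0; lia.
rewrite tok_ok_cat tread_cells //; cbn [fst snd]; rewrite tok_cons [wread _ _ [::]]/=.
by cbn [fst snd]; rewrite EP !tok_cells //; rewrite /wf_window /= /wT /wSmax /S0; lia.
Qed.

Lemma sim c tc : encodes c tc -> c.1 < qn -> exists2 tc', pass tc tc' & encodes (mstep prog c) tc'.
Proof.
case: c => q st [j [ws [-> /= _ jR wR cnt]]] lt.
have := wf_at lt; rewrite /mstep /=; case Ei: (instr_at prog q) => [r q'|r q1 q0|q'] /=.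
- move=> /andP[rR q'n]; exists (enc q' 0 (r :: ws)); first exact: sim_inc Ei jR wR.
  exists 0, (r :: ws); split => //=; first by rewrite rR.
  by move=> r'; rewrite /upd [r == r']eq_sym cnt; case: eqP => [->|].
- move=> /and3P[rR q1n q0n]; have jr : 2 * r.+1 <= 2 * R by lia.
  case Er: (st r) => [|k].
    exists (enc q0 (2 * r.+1) ws); last by exists (2 * r.+1), ws.
    apply: sim_dec0 Ei jR wR _ => //.
    by apply/count_memPn; rewrite cnt.
  have rw : r \in ws by rewrite -has_pred1 has_count cnt Er.
  have [u [v [Ew ru]]] := first_occ rw.
  exists (enc q1 (2 * r.+1) (u ++ v)); first by rewrite Ew; apply: sim_dec1 Ei jR _ ru => //; rewrite -Ew.
  exists (2 * r.+1), (u ++ v); split => //=.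
    by move: wR; rewrite Ew !all_cat /= => /and3P[-> _ ->].
  move=> r'; have := cnt r'; rewrite Ew !count_cat /= /upd [r == r']eq_sym.
  by case: eqP => [->|_] /=; rewrite ?Er; lia.
move=> q'n; exists (enc q' 0 ws); first exact: sim_jmp Ei jR wR.
by exists 0, ws.
Qed.

(** Halting with empty registers leaves the window b^A at an offset of [S0 + 1] times [wA]; after
    [wA - 1] skips a single letter remains. *)
Definition fin : tconfig := (wA * S0 + 1, [:: false]).

Lemma sim_halt tc : encodes (qn, fun=> 0) tc -> exists m, iter m tnextw tc = fin.
Proof.
case=> j [ws [-> _ jR _ cnt]].
have -> : ws = [::] by case: ws cnt => // r ws /(_ r); rewrite /= eqxx.
have := @head_pass (S0 + j) qn j [::] [::] (leqnn _).
rewrite Fx_halt /= subn0 => /(_ erefl jR).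
have -> : S0 + j + 1 - j = S0 + 1 by lia.
move=> H; have {H}[||m E] := H _ _ isT; [rewrite /wT /S0; lia | rewrite /wSmax; lia | ].
exists (wA.-1 + m.+1); rewrite iterD -/(enc _ _ _) E /conf.
have A0 : 0 < wA by have := wA_gt; have := wc0_gt0; lia.
have -> : tape [:: [::]] = nseq wA.-1 false ++ [:: false].
  rewrite /tape /= cats0 /raw /= subn0 -/wA -[X in nseq X false](prednK A0) -addn1 nseqD.
  by [].
have := @tr_run wjump wbl (wA * (S0 + 1)) (nseq wA.-1 false) [:: false] (or_introl _).
rewrite size_nseq => -> //; rewrite tr_skip size_nseq.
  by rewrite /fin /= mulnDr; congr pair; lia.
by rewrite mulnDr; lia.
Qed.

Hypothesis R0 : 0 < R.
(* Reading [unitw] at an offset [wA * S0] writes the window of [xc 0], and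
   returns to the same offset. *)
Definition unit_pre := wA * S0 + xc 0 * wbeta.
Definition unit_post := wA * (wbeta - 1) - unit_pre - 1.
Definition unitw := nseq unit_pre false ++ true :: nseq unit_post false.

Lemma unit_bounds : [/\ wA * (S0 + 3) < wbeta, xc 0 + wc0 < wA,
  unit_pre + 1 + unit_post = wA * (wbeta - 1) & 0 < unit_post].
Proof.
have h1 : wA * (S0 + 3) < wbeta.
  by rewrite ltnS leq_mul2l; apply/orP; right; rewrite /wSmax; lia.
have h2 := wA_gt; have h3 := xc_lt R0.
have h4 : xc 0 * wbeta + wbeta + wbeta <= wA * wbeta.
  by rewrite -!mulSnr leq_mul2r; apply/orP; right; lia.
have h5 : wA * (wbeta - 1) = wA * wbeta - wA by rewrite mulnBr muln1.
have h6 : wA * S0 + wA * 3 < wbeta by rewrite -mulnDr.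
by split => //; rewrite /unit_post /unit_pre ?h5; lia.
Qed.

(** The run reads [xc 0] letters b in steps of [wbeta], then the only c, then [wA - wc0 - xc 0]
    letters b; these are the rows of a one-payload window. *)
Lemma tr_unit : tr wjump wbl (wA * S0) unitw = (wA * S0, raw [:: xc 0]).
Proof.
have [h1' h2 h3 h4] := unit_bounds.
have h1 : wA * S0 + wA * 3 < wbeta by rewrite -mulnDr.
have A0 := wA_gt; have c00 := wc0_gt0.
have j0 := wjump0 wc0_gt0 wbetaP.
have szu : size unitw = wA * (wbeta - 1) by rewrite size_cat /= !size_nseq; lia.
have nthu p : nth false unitw p = (p == unit_pre).
  rewrite /unitw nth_cat size_nseq; case: ltnP => le; first by rewrite nth_nseq le; lia.
  case: eqP => [->|ne]; first by rewrite subnn.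
  have -> : p - unit_pre = (p - unit_pre).-1.+1 by lia.
  by rewrite /= nth_nseq; case: ifP.
have b1 : wA * (wbeta - 1) = wA * wbeta - wA by rewrite mulnBr muln1.
have kb k m : k < m -> k * wbeta + wbeta <= m * wbeta.
  by move=> km; rewrite -mulSnr leq_mul2r km orbT.
have cb : wbeta <= wc0 * wbeta by rewrite leq_pmull.
have e1 : wA * wbeta = (wA - wc0 - xc 0) * wbeta + wc0 * wbeta + xc 0 * wbeta.
  by rewrite -!mulnDl; congr (_ * _); lia.
rewrite (@tr_bs _ _ j0 (xc 0)) // => [|k km]; last first.
  have := kb _ _ km; rewrite nthu szu [wjump false]/= => h; split; last by apply/eqP; rewrite /unit_pre; lia.
  by rewrite /unit_post /unit_pre in h3; lia.
rewrite [wjump false]/= -/unit_pre tr_read //; last by rewrite szu; lia.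
rewrite nthu eqxx.
rewrite (@tr_bs _ _ j0 (wA - wc0 - xc 0)) // => [|k km]; last first.
  have := kb _ _ km; rewrite nthu szu /= -/wA => h; split.
    by rewrite /unit_pre; lia.
  by apply/eqP; lia.
rewrite tr_skip szu.
  cbn [fst snd]; rewrite cats0; congr pair; first by rewrite /= -/wA /unit_pre; lia.
  rewrite /raw /= mul0n subn0 !addn0 -/wA; do 2!congr (_ ++ _).
  by congr nseq; lia.
by rewrite /= -/wA /unit_pre; lia.
Qed.

(** Units are written as [unitw] and not as windows because [unitw] contains c only once: its code
    has a single entry 0, which a change of free generators can normalise. *)
Definition cinit n : tconfig := (wA * S0, raw [:: xh 0] ++ flatten (nseq n unitw)).

Lemma sim_init n : 0 < qn -> instr_at prog 0 = JMP 1 -> pass (cinit n) (enc 1 0 (nseq n 0)).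
Proof.
move=> q0 E0; have := wf_at q0; rewrite E0 /= => q1.
have x0 : xh 0 < wc0 by apply: xh_lt.
have big : (wA * S0).+1 < size (raw [:: xh 0] ++ flatten (nseq n unitw)).
  rewrite size_cat; apply: leq_trans (leq_addr _ _).
  by apply: (size_raw F wc0_gt0 wbetaP) => //; rewrite /wSmax; lia.
have := @tr_run wjump wbl (wA * S0) _ [::] (or_intror big); rewrite cats0.
have Er : tr wjump wbl (wA * S0) (raw [:: xh 0]) = (wA * S0, raw [:: xh 1]).
  rewrite (window_read wc0_gt0 wbetaP F_sorted F_c0 F_T F_S); last exact: wf1.
    rewrite wread1 // Fx_head // E0; cbn [fst snd size].
    have -> : (S0 + 2 - 1).-1 = S0 by lia.
    by rewrite /= cats0.
  by rewrite wok1 // /wT /wSmax /S0; lia.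
rewrite tr_cat Er; cbn [fst snd].
have -> : tr wjump wbl (wA * S0) (flatten (nseq n unitw)) = (wA * S0, flatten (nseq n (raw [:: xc 0]))).
  elim: n {big} => [|n IH] /=; first by case: (wA * S0).
  by rewrite tr_cat tr_unit; cbn [fst snd]; rewrite IH.
move=> E; move: big E; case: (size _) => // m _ E; exists m.
by rewrite /cinit E /enc /conf addn0 /tape /cells /= -map_comp map_nseq.
Qed.

Lemma tnext_small tc : size tc.2 <= 1 -> tnextw tc = tc.
Proof. by case: tc => o [|l [|m w]]. Qed.

Lemma size_enc q j ws : 1 < size (enc q j ws).2.
Proof.
rewrite /enc /conf /tape /= size_cat; apply: leq_trans (leq_addr _ _).
apply: leq_ltn_trans (size_raw F wc0_gt0 wbetaP (S := 0) _ _) => //; lia.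
Qed.

Theorem counter_tag n : 0 < qn -> instr_at prog 0 = JMP 1 ->
  ((exists t, iter t (mstep prog) (0, input n) = (qn, fun=> 0)) ->
     exists m, iter m tnextw (cinit n) = fin) /\
  ((forall t, (iter t (mstep prog) (0, input n)).1 < qn) ->
     forall m, 1 < size (iter m tnextw (cinit n)).2).
Proof.
move=> q0 E0; have [m0 E] := sim_init n q0 E0.
have r1 : encodes (mstep prog (0, input n)) (enc 1 0 (nseq n 0)).
  have := wf_at q0; rewrite E0 /= /mstep /= E0 => q1; exists 0, (nseq n 0); split => //.
    by rewrite all_nseq R0 orbT.
  by move=> r; rewrite count_nseq /input /upd /= eq_sym; case: eqP; rewrite ?mul1n.
split=> [[t Et]|inf].
  have {Et} : iter t (mstep prog) (mstep prog (0, input n)) = (qn, fun=> 0).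
    by rewrite -iterSr iterS Et; apply: (@mstep_stuck prog (qn, _) 1); rewrite leqnn.
  suff H : forall c tc, encodes c tc -> iter t (mstep prog) c = (qn, fun=> 0) -> exists m, iter m tnextw tc = fin.
    by move=> /(H _ _ r1) [m Em]; exists (m + m0.+1); rewrite iterD E.
  elim: t => [|t IH] c tc rc; first by move=> /= Ec; apply: sim_halt; rewrite -Ec.
  rewrite iterSr; have [lt|ge] := ltnP c.1 qn.
    have [tc' [m <-] r'] := sim rc lt => /(IH _ _ r') [m' Em].
    by exists (m' + m.+1); rewrite iterD.
  by rewrite -iterSr mstep_stuck // => Ec; apply: sim_halt; rewrite -Ec.
(* Encoded configurations occur arbitrarily late and have several letters, while a configuration of
   at most one letter would be a fixed point. *)
have run k : exists m tc, [/\ k <= m, iter m tnextw (cinit n) = tc &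
    encodes (iter k.+1 (mstep prog) (0, input n)) tc].
  elim: k => [|k [m [tc [km Em rk]]]]; first by exists m0.+1, (enc 1 0 (nseq n 0)).
  have [tc' [m' Em'] r'] := sim rk (inf _).
  by exists (m'.+1 + m), tc'; split => //; [lia | rewrite iterD Em].
move=> m; rewrite ltnNge; apply/negP => small.
have stuck d : iter (d + m) tnextw (cinit n) = iter m tnextw (cinit n).
  by elim: d => // d IH; rewrite addSn iterS IH tnext_small.
have [m' [tc [mm' Em [j [ws [Etc _ _ _ _]]]]]] := run m.
move: small; rewrite -(stuck (m' - m)) subnK // Em Etc leqNgt.
by rewrite size_enc.
Qed.

End Simulation.

Import GRing.Theory.

(** * Encoding of coefficients *)

Definition cfn n (g : n.-tuple nat -> nat) := exists r : recfun n, forall x, computes r x (g x).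

Lemma cfn_ext n (g h : n.-tuple nat -> nat) : g =1 h -> cfn g -> cfn h.
Proof. by move=> gh [r Hr]; exists r => x; rewrite -gh. Qed.

Lemma cfn_proj n (i : 'I_n) : cfn (fun x => tnth x i).
Proof. by exists (RProj i). Qed.

Lemma cfn_comp m n (f : m.-tuple nat -> nat) (g : 'I_m -> n.-tuple nat -> nat) :
  cfn f -> (forall i, cfn (g i)) -> cfn (fun x => f [tuple g i x | i < m]).
Proof.
move=> [rf Hf] /fin_all_exists [rg Hg]; exists (RComp rf rg) => x /=.
by exists [tuple g i x | i < m] => // i; rewrite tnth_mktuple.
Qed.

Lemma cfn_succ n (g : n.-tuple nat -> nat) : cfn g -> cfn (fun x => (g x).+1).
Proof.
move=> Hg; have H1 : cfn (fun x : 1.-tuple nat => (thead x).+1) by exists RSucc.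
apply: cfn_ext (cfn_comp H1 (fun=> Hg)) => x.
by rewrite /thead tnth_mktuple.
Qed.

Lemma cfn_const n c : cfn (fun _ : n.-tuple nat => c).
Proof. by elim: c => [|c IH]; [exists (RZero n) | apply: cfn_succ]. Qed.

Fixpoint prv n (F : n.-tuple nat -> nat) (G : n.+2.-tuple nat -> nat) k x :=
  if k is k'.+1 then G (cons_tuple k' (cons_tuple (prv F G k' x) x)) else F x.

Lemma cfn_prec n (F : n.-tuple nat -> nat) G : cfn F -> cfn G ->
  cfn (fun x : n.+1.-tuple nat => prv F G (thead x) (behead_tuple x)).
Proof.
move=> [rF HF] [rG HG]; exists (RPrec rF rG) => x /=.
by elim: (thead x) => //= k IH; exists (prv F G k (behead_tuple x)).
Qed.

Lemma cfn_bin (op : nat -> nat -> nat) : cfn (fun x : 2.-tuple nat => op (tnth x 0%R) (tnth x 1%R)) ->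
  forall n (g h : n.-tuple nat -> nat), cfn g -> cfn h -> cfn (fun x => op (g x) (h x)).
Proof.
move=> Hop n g h Hg Hh.
have Hi (i : 'I_2) : cfn (if i == 0%R then g else h) by case: ifP.
by apply: cfn_ext (cfn_comp Hop Hi) => x; rewrite !tnth_mktuple.
Qed.

Lemma cfn_add n (g h : n.-tuple nat -> nat) : cfn g -> cfn h -> cfn (fun x => g x + h x).
Proof.
apply: cfn_bin.
apply: cfn_ext (cfn_prec (cfn_proj (0%R : 'I_1)) (cfn_succ (cfn_proj (1%R : 'I_3)))) => x.
rewrite /thead; move: (tnth x 0%R) => k; elim: k => [|k IH]; last by rewrite addSn -IH /= !(tnth_nth 0).
by rewrite /= !(tnth_nth 0) nth_behead.
Qed.

Lemma cfn_pred n (g : n.-tuple nat -> nat) : cfn g -> cfn (fun x => (g x).-1).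
Proof.
move=> Hg; have H1 : cfn (fun x : 1.-tuple nat => (thead x).-1).
  apply: cfn_ext (cfn_prec (cfn_const 0 0) (cfn_proj (0%R : 'I_2))) => x.
  by case: (thead x).
apply: cfn_ext (cfn_comp H1 (fun=> Hg)) => x.
by rewrite /thead tnth_mktuple.
Qed.

Lemma cfn_sub n (g h : n.-tuple nat -> nat) : cfn g -> cfn h -> cfn (fun x => g x - h x).
Proof.
move=> Hg Hh; apply: (cfn_bin (op := fun a b => b - a)) Hh Hg.
apply: cfn_ext (cfn_prec (cfn_proj (0%R : 'I_1)) (cfn_pred (cfn_proj (1%R : 'I_3)))) => x.
rewrite /thead; move: (tnth x 0%R) => k; elim: k => [|k IH]; last by rewrite subnS -IH /= !(tnth_nth 0).
by rewrite /= !(tnth_nth 0) nth_behead subn0.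
Qed.

Lemma cfn_mul n (g h : n.-tuple nat -> nat) : cfn g -> cfn h -> cfn (fun x => g x * h x).
Proof.
apply: cfn_bin.
apply: cfn_ext (cfn_prec (cfn_const 1 0) (cfn_add (cfn_proj (1%R : 'I_3)) (cfn_proj (inord 2 : 'I_3)))) => x.
rewrite /thead; move: (tnth x 0%R) => k; elim: k => [|k IH] //; rewrite mulSn addnC -IH; congr addn.
rewrite !(tnth_nth 0) /= inordK //=.
by rewrite nth_behead.
Qed.

(** The increment is 1 exactly when the next square is at most [k]; the test is written with
    truncated subtraction to be visibly primitive recursive. *)
Fixpoint isqrt k :=
  if k is k'.+1 then isqrt k' + (1 - ((isqrt k').+1 * (isqrt k').+1 - k'.+1)) else 0.

Lemma isqrtP k : isqrt k * isqrt k <= k < (isqrt k).+1 * (isqrt k).+1.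
Proof.
elim: k => // k; rewrite /= -/isqrt; move: (isqrt k) => s /andP[h1 h2].
have [le|gt] := leqP (s.+1 * s.+1) k.+1.
  have -> : s.+1 * s.+1 - k.+1 = 0 by lia.
  by rewrite subn0 addn1; apply/andP; split; nia.
have -> : 1 - (s.+1 * s.+1 - k.+1) = 0 by lia.
by rewrite addn0; lia.
Qed.

Lemma isqrt_eq s a : a <= 2 * s -> isqrt (s * s + a) = s.
Proof. by move=> le; have /andP[] := isqrtP (s * s + a); nia. Qed.

Definition cf1 (g : nat -> nat) := cfn (fun x : 1.-tuple nat => g (thead x)).

Lemma cf1_comp g h : cf1 g -> cf1 h -> cf1 (fun x => g (h x)).
Proof.
move=> Hg Hh; apply: cfn_ext (cfn_comp Hg (fun=> Hh)) => x.
by rewrite /thead tnth_mktuple.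
Qed.

Lemma cf1_id : cf1 id. Proof. exact: cfn_proj. Qed.

Lemma cf1_isqrt : cf1 isqrt.
Proof.
have k2 := cfn_proj (0%R : 'I_2); have s2 := cfn_proj (1%R : 'I_2).
have := cfn_add s2 (cfn_sub (cfn_const 2 1) (cfn_sub (cfn_mul (cfn_succ s2) (cfn_succ s2)) (cfn_succ k2))).
move=> HG; apply: cfn_ext (cfn_prec (cfn_const 0 0) HG) => x.
by elim: (thead x) => //= k ->; rewrite !(tnth_nth 0) /=.
Qed.

(** The pair coded is the one with [x = (a + b)^2 + a]; the root is [a + b] because
    [a <= 2 (a + b)]. *)
Definition unpair1 x := x - isqrt x * isqrt x.
Definition unpair2 x := isqrt x - unpair1 x.

Lemma cf1_unpair1 : cf1 unpair1.
Proof. by apply: cfn_sub cf1_id _; apply: cfn_mul; exact: cf1_isqrt. Qed.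

Lemma cf1_unpair2 : cf1 unpair2.
Proof. exact: cfn_sub cf1_isqrt cf1_unpair1. Qed.

Lemma unpair_surj a b : exists x, unpair1 x = a /\ unpair2 x = b.
Proof.
exists ((a + b) * (a + b) + a); rewrite /unpair2 /unpair1 isqrt_eq; last by lia.
by split; lia.
Qed.

Fixpoint decode k x := if k is k'.+1 then decode k' (unpair2 x) else unpair1 x.

Lemma cf1_decode k : cf1 (decode k).
Proof.
elim: k => [|k IH]; first exact: cf1_unpair1.
exact: cf1_comp IH cf1_unpair2.
Qed.

Lemma decode_surj N (a : nat -> nat) : exists x, forall k, k < N -> decode k x = a k.
Proof.
elim: N a => [|N IH] a; first by exists 0.
have [y Hy] := IH (fun k => a k.+1).
have [x [x1 x2]] := unpair_surj (a 0) y.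
by exists x => -[|k] lt //=; rewrite x2 Hy.
Qed.

(** A form without case distinction: one of the two truncated differences vanishes, and for [u < v]
    the code of [u - v] is [2 (v - u) - 1]. *)
Lemma int_code_sub (u v : nat) :
  int_code (u%:Z - v%:Z)%R = 2 * (u - v) + (2 * (v - u) - 1).
Proof.
have [le|lt] := leqP v u.
  have -> : (u%:Z - v%:Z)%R = Posz (u - v) by lia.
  by rewrite /=; lia.
have -> : (u%:Z - v%:Z)%R = Negz (v - u).-1 by lia.
by rewrite /=; lia.
Qed.

(* Six consecutive numbers decoded from [x] are the positive and negative parts
   of the coefficients of a quadratic polynomial, to be evaluated at [x]. *)
Definition quad_nat j x := decode j x + x * decode j.+1 x + x * x * decode j.+2 x.

Lemma cf1_quad_nat j : cf1 (quad_nat j).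
Proof.
have d k := cf1_decode k; have i := cf1_id.
exact: cfn_add (cfn_add (d j) (cfn_mul i (d j.+1))) (cfn_mul (cfn_mul i i) (d j.+2)).
Qed.

Definition entry_code j x :=
  int_code ((quad_nat (6 * j) x)%:Z - (quad_nat (6 * j + 3) x)%:Z)%R.

Lemma cf1_entry_code j : cf1 (entry_code j).
Proof.
have u := cf1_quad_nat (6 * j); have v := cf1_quad_nat (6 * j + 3).
have H : cf1 (fun x => 2 * (quad_nat (6 * j) x - quad_nat (6 * j + 3) x) +
    (2 * (quad_nat (6 * j + 3) x - quad_nat (6 * j) x) - 1)).
  have c2 := cfn_const 1 2.
  exact: cfn_add (cfn_mul c2 (cfn_sub u v)) (cfn_sub (cfn_mul c2 (cfn_sub v u)) (cfn_const 1 1)).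
by apply: cfn_ext H => x; rewrite /entry_code int_code_sub.
Qed.

Definition int_pos (z : int) : nat := if z is Posz m then m else 0.
Definition int_neg (z : int) : nat := if z is Negz m then m.+1 else 0.

Lemma int_pos_neg z : z = ((int_pos z)%:Z - (int_neg z)%:Z)%R.
Proof. by case: z => m /=; lia. Qed.

(** The self-reference is here: the same [x] is the code of the coefficients and the point at which
    the polynomials are evaluated. *)
Lemma entry_surj (c : nat -> nat -> int) N : exists x, forall j, j < N ->
  entry_code j x = int_code (c j 0 + c j 1 *+ x + c j 2 *+ (x * x))%R.
Proof.
have [x Hx] := decode_surj (6 * N) (fun k => if k %% 6 < 3 then int_pos (c (k %/ 6) (k %% 6))
  else int_neg (c (k %/ 6) (k %% 6 - 3))).
exists x => j jN; rewrite /entry_code; congr int_code.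
have D i : i < 6 -> decode (6 * j + i) x =
    if i < 3 then int_pos (c j i) else int_neg (c j (i - 3)).
  move=> i6; rewrite Hx; last by lia.
  by have -> : (6 * j + i) %% 6 = i; [lia | have -> : (6 * j + i) %/ 6 = j by lia].
rewrite /quad_nat; move: (D 0 isT) (D 1 isT) (D 2 isT) (D 3 isT) (D 4 isT) (D 5 isT).
rewrite !addnS !addn0 => -> -> -> -> -> ->.
rewrite -[if 0 < 3 then _ else _]/(int_pos (c j 0)) -[if 1 < 3 then _ else _]/(int_pos (c j 1)).
rewrite -[if 2 < 3 then _ else _]/(int_pos (c j 2)) -[if 3 < 3 then _ else _]/(int_neg (c j 0)).
rewrite -[if 4 < 3 then _ else _]/(int_neg (c j 1)) -[if 5 < 3 then _ else _]/(int_neg (c j 2)).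
move: (int_pos_neg (c j 0)) (int_pos_neg (c j 1)) (int_pos_neg (c j 2)).
move: (int_pos (c j 0)) (int_pos (c j 1)) (int_pos (c j 2)) => p0 p1 p2.
move: (int_neg (c j 0)) (int_neg (c j 1)) (int_neg (c j 2)) => n0 n1 n2 -> -> ->.
have M (z : int) m : (z *+ m = z * m%:Z)%R by rewrite -mulr_natr natz.
by rewrite !M !PoszD !PoszM; ring.
Qed.

Import Order.TTheory GRing.Theory Num.Theory.

(** * A free family in SL(2, Z) *)

(* Words in the generators [nat] and their formal inverses: [(i, true)] stands
   for the generator [i] and [(i, false)] for its inverse. *)
Definition word := seq (nat * bool).

Definition linv (x : nat * bool) := (x.1, ~~ x.2).
Definition winv (w : word) : word := rev (map linv w).
Definition rcat (x y : nat * bool) := y != linv x.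
Definition push (x : nat * bool) (r : word) : word :=
  if r is y :: r' then if y == linv x then r' else x :: r else [:: x].
Definition red (w : word) : word := foldr push [::] w.
Definition pos (u : seq nat) : word := [seq (i, true) | i <- u].

Lemma linvK : involutive linv.
Proof. by case=> i b; rewrite /linv /= negbK. Qed.

Lemma rcat_sym x y : rcat (linv x) (linv y) = rcat y x.
Proof. by rewrite /rcat linvK; congr (~~ _); apply/eqP/eqP => [<-|->]; rewrite ?linvK. Qed.

Lemma push_sorted x r : sorted rcat r -> sorted rcat (push x r).
Proof.
case: r => [//|y r] /= srt; case: ifP => [_|/negbT ne]; first exact: path_sorted srt.
by rewrite /= srt andbT.
Qed.

Lemma red_sorted w : sorted rcat (red w).
Proof. by elim: w => //= x w IH; apply: push_sorted. Qed.

Lemma red_id w : sorted rcat w -> red w = w.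
Proof.
elim: w => //= x w IH srt; rewrite IH ?(path_sorted srt) //.
by case: w srt {IH} => //= y w /andP[/negbTE]; rewrite /rcat => ->.
Qed.

Lemma push_all (p : pred (nat * bool)) x r : p x -> all p r -> all p (push x r).
Proof. by move=> px; case: r => /= [|y r /andP[py pr]]; rewrite ?px //; case: ifP => //= _; rewrite px py. Qed.

Lemma red_all (p : pred (nat * bool)) w : all p w -> all p (red w).
Proof. by elim: w => //= x w IH /andP[px pw]; apply: push_all => //; apply: IH. Qed.

Lemma winv_cat u v : winv (u ++ v) = winv v ++ winv u.
Proof. by rewrite /winv map_cat rev_cat. Qed.

Lemma winv_sorted w : sorted rcat w -> sorted rcat (winv w).
Proof.
rewrite /winv rev_sorted sorted_map.
by case: w => //= x w; apply: sub_path => y z; rewrite /= rcat_sym.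
Qed.

Lemma pos_sorted u : sorted rcat (pos u).
Proof. by case: u => //= i u; elim: u i => //= j u IH i; rewrite IH /rcat xpair_eqE andbF. Qed.

Lemma pos_inj : injective pos.
Proof. by apply: inj_map; move=> i j []. Qed.

Lemma pos_cat u v : pos (u ++ v) = pos u ++ pos v.
Proof. exact: map_cat. Qed.

Section Eval.
Local Open Scope ring_scope.
Variables (R : unitRingType) (A : nat -> R).
Hypothesis Aunit : forall i, A i \is a GRing.unit.

Definition lev (x : nat * bool) : R := if x.2 then A x.1 else (A x.1)^-1.
Definition ev (w : word) : R := \prod_(x <- w) lev x.

Lemma ev_nil : ev [::] = 1. Proof. by rewrite /ev big_nil. Qed.
Lemma ev_cons x w : ev (x :: w) = lev x * ev w. Proof. by rewrite /ev big_cons. Qed.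
Lemma ev_cat u v : ev (u ++ v) = ev u * ev v. Proof. by rewrite /ev big_cat. Qed.

Lemma lev_unit x : lev x \is a GRing.unit.
Proof. by rewrite /lev; case: x.2; rewrite ?unitrV. Qed.

Lemma ev_unit w : ev w \is a GRing.unit.
Proof. by elim: w => [|x w IH]; rewrite ?ev_nil ?unitr1 // ev_cons unitrMl ?lev_unit. Qed.

Lemma lev_linv x : lev (linv x) = (lev x)^-1.
Proof. by case: x => i []; rewrite /lev /= ?invrK. Qed.

Lemma ev_winv w : ev (winv w) = (ev w)^-1.
Proof.
elim: w => [|x w IH]; first by rewrite ev_nil invr1.
rewrite -cat1s winv_cat !ev_cat IH invrM ?ev_unit //; congr (_ * _).
by rewrite /ev !big_seq1 lev_linv.
Qed.

Lemma ev_push x r : ev (push x r) = lev x * ev r.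
Proof.
case: r => [|y r] /=; first by rewrite ev_cons.
case: eqP => [->|_]; last by rewrite ev_cons.
by rewrite ev_cons lev_linv mulVKr ?lev_unit.
Qed.

Lemma ev_red w : ev (red w) = ev w.
Proof. by elim: w => //= x w IH; rewrite ev_push IH ev_cons. Qed.

Lemma red_nil_ev w : red w = [::] -> ev w = 1.
Proof. by rewrite -ev_red => ->; rewrite ev_nil. Qed.

Definition free_family := forall w, ev w = 1 -> red w = [::].

Hypothesis Afree : free_family.

(** For reduced words, equal first letters cancel; if they differ, [winv u ++ v] is already reduced,
    and freeness would make it empty. *)
Lemma ev_inj_red u v : ev u = ev v -> red u = red v.
Proof.
rewrite -(ev_red u) -(ev_red v).
move: (red u) (red v) (red_sorted u) (red_sorted v) => {}u {}v.
elim: u v => [|x u IH] [|y v] su sv //.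
- by move/esym; rewrite ev_nil => /Afree; rewrite red_id.
- by rewrite ev_nil => /Afree; rewrite red_id.
case: (x =P y) => [-> | xy] E.
  congr cons; apply: IH; [exact: path_sorted su | exact: path_sorted sv |].
  by move: E; rewrite !ev_cons => /(mulrI (lev_unit y)).
have : ev (winv (x :: u) ++ y :: v) = 1 by rewrite ev_cat ev_winv E mulVr ?ev_unit.
move/Afree; rewrite red_id.
  by rewrite -cat1s winv_cat; case: (winv u).
rewrite -cat1s winv_cat -catA /= sorted_cat_cons.
have := winv_sorted su; rewrite -cat1s winv_cat cats1 => -> /=.
by move: sv => /= ->; rewrite andbT /rcat linvK eq_sym; apply/eqP.
Qed.

Lemma ev_pos_inj u v : ev (pos u) = ev (pos v) -> u = v.
Proof. by move/ev_inj_red; rewrite !red_id ?pos_sorted // => /pos_inj. Qed.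

End Eval.

(** * Transvections and ping-pong *)

Section Matrices.
Local Open Scope ring_scope.

Definition mx2 (R : nzRingType) (a b c d : R) : 'M[R]_2 :=
  \matrix_(i < 2, j < 2) if i == 0 then (if j == 0 then a else b)
                         else (if j == 0 then c else d).

Lemma ord2E (i : 'I_2) : i = 0 \/ i = 1.
Proof. by case: i => [[|[|//]] lti]; [left|right]; apply: val_inj. Qed.

Lemma mx2P (R : nzRingType) (M N : 'M[R]_2) :
  M 0 0 = N 0 0 -> M 0 1 = N 0 1 -> M 1 0 = N 1 0 -> M 1 1 = N 1 1 -> M = N.
Proof. by move=> a b c d; apply/matrixP => i j; case: (ord2E i) => ->; case: (ord2E j) => ->. Qed.

Lemma mx2M (R : nzRingType) (M N : 'M[R]_2) (i j : 'I_2) :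
  (M * N) i j = M i 0 * N 0 j + M i 1 * N 1 j.
Proof.
rewrite mxE big_ord_recl big_ord1.
by have -> : lift ord0 ord0 = 1 :> 'I_2 by apply: val_inj.
Qed.

Lemma mx2_det (R : comNzRingType) (M : 'M[R]_2) :
  \det M = M 0 0 * M 1 1 - M 0 1 * M 1 0.
Proof.
rewrite (expand_det_row _ 0) big_ord_recl big_ord1 /cofactor !det_mx11 !mxE /=.
have -> : lift ord0 ord0 = 1 :> 'I_2 by apply: val_inj.
have -> : lift 1 0 = 0 :> 'I_2 by apply: val_inj.
by rewrite /= !addn0 expr0 expr1 mul1r mulN1r mulrN.
Qed.

(** The transvection that adds [5 (y - i x)] times its fixed vector [(1, i)] to [(x, y)]. The factor
    5 is large enough for ping-pong on cones around the directions [(1, i)]. *)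
Definition X (i : nat) : 'M[int]_2 :=
  mx2 (1 - 5 * i%:Z) 5 (- 5 * i%:Z ^+ 2) (1 + 5 * i%:Z).
Definition XV (i : nat) : 'M[int]_2 :=
  mx2 (1 + 5 * i%:Z) (- 5) (5 * i%:Z ^+ 2) (1 - 5 * i%:Z).

Lemma X_XV i : X i * XV i = 1.
Proof. by apply: mx2P; rewrite mx2M !mxE /=; ring. Qed.

Lemma XV_X i : XV i * X i = 1.
Proof. by apply: mx2P; rewrite mx2M !mxE /=; ring. Qed.

Lemma X_unit i : X i \is a GRing.unit.
Proof. by apply/unitrP; exists (XV i); rewrite X_XV XV_X. Qed.

Lemma X_inv i : (X i)^-1 = XV i.
Proof. by rewrite -[LHS]mulr1 -(X_XV i) mulKr ?X_unit. Qed.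

Definition act (M : 'M[int]_2) (v : int * int) : int * int :=
  (M 0 0 * v.1 + M 0 1 * v.2, M 1 0 * v.1 + M 1 1 * v.2).

Lemma actM M N v : act (M * N) v = act M (act N v).
Proof. by rewrite /act !mx2M /=; congr pair; ring. Qed.

(* The ping-pong regions: [y - i x] is invariant under [X i], and the regions
   of [i] lie in the cone [|2 (y - i x)| < |x|]. *)
Definition pp (x : nat * bool) (v : int * int) : Prop :=
  let f := v.2 - x.1%:Z * v.1 in
  let g := if x.2 then f else - f in
  (0 < g /\ 2 * g < v.1) \/ (g < 0 /\ v.1 < 2 * g).

Lemma act_lev x v :
  let f := v.2 - x.1%:Z * v.1 in
  let g := if x.2 then f else - f in
  act (lev X x) v = (v.1 + 5 * g, v.2 + 5 * x.1%:Z * g).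
Proof.
by case: x v => i [] [x y]; rewrite /lev /= ?X_inv /act /= !mxE /=; congr pair; ring.
Qed.

Lemma cone_disjoint (i j : nat) (x y : int) : i != j ->
  `|2 * (y - j%:Z * x)| < `|x| -> `|x| < `|2 * (y - i%:Z * x)|.
Proof.
move=> /eqP ne.
have -> : y - i%:Z * x = (y - j%:Z * x) + (j%:Z - i%:Z) * x by ring.
set f := y - _; have [ij|ij] := ltnP i j.
  have -> : (j%:Z - i%:Z) = 1 + (j - i.+1)%N%:Z by lia.
  by nia.
have -> : (j%:Z - i%:Z) = - 1 - (i - j.+1)%N%:Z by lia.
by nia.
Qed.

(** The start [(0, 1)] lies in no cone. A vector in the cone of another generator has [|u| < |2 f|],
    and adding [5 g] to [u] moves it into the region of [x]; for the same generator, reducedness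
    excludes the opposite sign. *)
Lemma ppP w x : sorted rcat (x :: w) -> pp x (act (ev X (x :: w)) (0, 1)).
Proof.
elim: w x => [|y w IH] x srt.
  rewrite ev_cons ev_nil mulr1 act_lev /pp /=; case: x.2; lia.
rewrite ev_cons actM; move: {IH}(IH y (path_sorted srt)).
move: (act _ _) => [u v]; rewrite act_lev.
move: srt => /= /andP[+ _]; case: x y => [i e] [j d]; rewrite /rcat /linv /= xpair_eqE.
set f := v - i%:Z * u; set g := if e then f else - f.
have fg : (v + 5 * i%:Z * g) - i%:Z * (u + 5 * g) = f by rewrite /f; ring.
rewrite /pp /= fg.
have [-> /= | ne _] := eqVneq j i.
  rewrite -/f -/g; case: d => /=; case: e @g fg => /= _ //; rewrite -/f; lia.
move=> H; have : `|u| < `|2 * f|.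
  apply: (@cone_disjoint i j); first by rewrite eq_sym.
  by move: H; case: d; lia.
by move: fg => _; rewrite -/g /g; case: e @g; lia.
Qed.

Lemma X_free : free_family X.
Proof.
move=> w; rewrite -(ev_red X_unit).
case: (red w) (red_sorted w) => [//|x r] srt E.
have := ppP srt; rewrite E /act /pp !mxE /=; case: x.2; lia.
Qed.

End Matrices.

(** * Counting in free products *)

(** What a relation saying that the product of the [g_i z^(e_i)] is 1, with nonzero exponents,
    implies in a free product: nontrivial [g_i] are scarce, fewer than two per negative exponent. *)
Definition balanced (R : pzRingType) (l : seq (R * int)) : Prop :=
  (\sum_(p <- l) p.2 = 0)%R /\
  count (fun p => p.1 != 1)%R l + 2 <= 2 * count (fun p => p.2 < 0)%R l.

Lemma balanced_perm (R : pzRingType) (l l' : seq (R * int)) :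
  perm_eq l l' -> balanced l' -> balanced l.
Proof. by move=> pe; rewrite /balanced (perm_big _ pe) !(permP pe). Qed.

Lemma opp_neg (x y : int) : (x + y = 0 -> y != 0 ->
  (0 + (0 + 0) + 2 <= 2 * ((x < 0)%R + ((y < 0)%R + 0)))%N)%R.
Proof. lia. Qed.

Lemma opp_neg1 (x y : int) : (x + y = 0 -> y != 0 ->
  ((x < 0)%R + (y < 0)%R = 1)%N)%R.
Proof. lia. Qed.

Section Counting.
Local Open Scope ring_scope.
Variables (R : unitRingType) (H : R -> Prop) (z : R).

Definition zprod (l : seq (R * int)) : R := \prod_(p <- l) (p.1 * z ^ p.2).

Lemma zprod_nil : zprod [::] = 1. Proof. exact: big_nil. Qed.
Lemma zprod_cons p l : zprod (p :: l) = p.1 * z ^ p.2 * zprod l.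
Proof. exact: big_cons. Qed.
Lemma zprod_cat l1 l2 : zprod (l1 ++ l2) = zprod l1 * zprod l2.
Proof. exact: big_cat. Qed.

Hypothesis zunit : z \is a GRing.unit.
Hypothesis Hunit : forall g, H g -> g \is a GRing.unit.
Hypothesis HM : forall g h, H g -> H h -> H (g * h).
Hypothesis zexp : forall e : int, z ^ e = 1 -> e = 0.
Hypothesis NF : forall l, l <> [::] ->
  {in l, forall p, [/\ H p.1, p.1 != 1 & p.2 != 0]} -> zprod l <> 1.

Lemma unitr1C (x y : R) : y \is a GRing.unit -> x * y = 1 -> y * x = 1.
Proof. by move=> uy E; rewrite -[x](mulrK uy) E mul1r mulrV. Qed.

Lemma zprod_unit l : {in l, forall p, H p.1} -> zprod l \is a GRing.unit.
Proof.
elim: l => [|p l IH] h; first by rewrite zprod_nil unitr1.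
rewrite zprod_cons unitrMr; first by apply: IH => q ql; apply: h; rewrite inE ql orbT.
by rewrite unitrMr ?unitrXz //; apply: Hunit; apply: h; rewrite mem_head.
Qed.

(* Merge at a trivial [g], after rotating it to the second place: each merge
   either keeps both counts or trades one negative exponent for at most two
   nontrivial [g]. *)
Lemma counting l : l <> [::] -> {in l, forall p, H p.1 /\ p.2 != 0} ->
  zprod l = 1 ->
  balanced l.
Proof.
have [n] := ubnP (size l); elim: n l => // n IH l szl l0 hl E.
have [/hasP[[g e] tl /eqP /= g1] | /hasPn ntr] := boolP (has (fun p => p.1 == 1) l); last first.
  by case: (NF l0 _ E) => p pl; case: (hl p pl) => Hp ep; split => //; apply: ntr.
move: tl; rewrite {g}g1 => tl.
case/splitPr: tl szl hl E {l0} => l1 l2 szl hl E.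
have {szl IH} IH a m : perm_eq (l2 ++ l1) (a :: m) ->
    zprod (a :: (1, e) :: m) = 1 ->
    {in a :: (1, e) :: m, forall p, H p.1 /\ p.2 != 0} ->
  balanced (a :: (1, e) :: m).
  move=> /perm_size /= szm {hl}E hl; move: szl; rewrite size_cat /= addnS ltnS -addnC -size_cat szm => szl.
  have [Ha ea] := hl a (mem_head _ _).
  have [_ ee] : H 1 /\ e != 0 by apply: (hl (1, e)); rewrite !inE eqxx orbT.
  have hm p : p \in m -> H p.1 /\ p.2 != 0 by move=> pm; apply: hl; rewrite !inE pm !orbT.
  have mrg : a.1 * z ^ (a.2 + e) * zprod m = 1.
    by rewrite -E !zprod_cons /= mul1r exprzDr // !mulrA.
  have [s0 | s1] := eqVneq (a.2 + e) 0; last first.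
    have [|//||| S C] := IH ((a.1, a.2 + e) :: m).
    - by move: szl => /=; lia.
    - by move=> p; rewrite inE => /orP[/eqP -> //|]; apply: hm.
    - by rewrite zprod_cons.
    rewrite /balanced !big_cons /=; move: S C; rewrite /balanced !big_cons /= => S C; split; first by rewrite addrA.
    by move: C; rewrite eqxx /=; lia.
  move: mrg; rewrite s0 expr0z mulr1.
  case: m szl hm {hl E szm} => [|b m] szl hm.
    rewrite zprod_nil mulr1 => a1.
    rewrite /balanced !big_cons big_nil /= a1 eqxx addr0 s0; split => //=.
    by apply: opp_neg.
  rewrite zprod_cons => E.
  have [|//||| S C] := IH ((a.1 * b.1, b.2) :: m).
  - by move: szl => /=; lia.
  - move=> p; rewrite inE => /orP[/eqP -> /=|pm]; last by apply: hm; rewrite inE pm orbT.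
    by have [Hb eb] := hm b (mem_head _ _); split => //; apply: HM.
  - by rewrite zprod_cons -E /= !mulrA.
  rewrite /balanced !big_cons /=; move: S C; rewrite /balanced !big_cons /= => S C; split; first by rewrite addrA s0 add0r.
  by have := opp_neg1 s0 ee; move: C; rewrite eqxx /=; case: (a.1 != 1); case: (b.1 != 1); case: (_ != _) => /=; lia.
have {}E : zprod ((1, e) :: (l2 ++ l1)) = 1.
  rewrite -cat_cons zprod_cat; apply: unitr1C; last by rewrite -zprod_cat.
  by apply: zprod_unit => p pl; case: (hl p) => //; rewrite mem_cat pl orbT.
have pe : perm_eq (l1 ++ (1, e) :: l2) ((1, e) :: l2 ++ l1) by rewrite -cat_cons perm_catC.
apply: (balanced_perm pe).
have {pe}hl : {in (1, e) :: l2 ++ l1, forall p, H p.1 /\ p.2 != 0}.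
  by move=> p pl; apply: hl; rewrite (perm_mem pe).
case/lastP: (l2 ++ l1) E hl IH => [|m a] E hl IH.
  by move: E; rewrite zprod_cons zprod_nil mulr1 mul1r => /zexp e0; have [_] := hl (1, e) (mem_head _ _); rewrite e0.
have pe : perm_eq ((1, e) :: rcons m a) (a :: (1, e) :: m).
  by rewrite -[rcons m a]cats1 -cat_cons -(cat1s a) perm_catC.
apply: (balanced_perm pe); apply: IH.
- by rewrite perm_rcons.
- rewrite -cat1s zprod_cat; apply: unitr1C.
    apply: zprod_unit => p; rewrite inE => /eqP ->.
    by case: (hl a) => //; rewrite inE mem_rcons mem_head orbT.
  by rewrite -zprod_cat /= cats1.
- by move=> p pl; apply: hl; rewrite (perm_mem pe).
Qed.

End Counting.

Lemma rcat_sorted_cat u v : sorted rcat u -> sorted rcat v ->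
  (forall u' x y v', u = rcons u' x -> v = y :: v' -> rcat x y) ->
  sorted rcat (u ++ v).
Proof.
case/lastP: u => [//|u x]; case: v => [|y v]; first by rewrite cats0.
move=> su sv /(_ u x y v erefl erefl) xy.
by rewrite cat_rcons sorted_cat_cons su /= xy.
Qed.

(** * A free group as the free product of one generator and the others *)

Section FreeNF.
Local Open Scope ring_scope.
Variables (R : unitRingType) (A : nat -> R).
Hypothesis Aunit : forall i, A i \is a GRing.unit.
Hypothesis Afree : free_family A.
Variable zi : nat.

Definition zfree_word (w : word) := all (fun x => x.1 != zi) w.
Definition zfree (g : R) := exists2 w, zfree_word w & g = ev A w.

Definition zword (e : int) : word :=
  nseq `|e|%N (zi, if e is Posz _ then true else false).

Lemma ev_zword e : ev A (zword e) = A zi ^ e.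
Proof.
have evn m x : ev A (nseq m x) = lev A x ^+ m by rewrite /ev big_nseq iter_mulr_1.
by case: e => m; rewrite /zword evn /lev /= ?NegzE // exprVn.
Qed.

Lemma zword_sorted e : sorted rcat (zword e).
Proof.
rewrite /zword; move: `|e|%N (match e with Posz _ => _ | _ => _ end) => n b.
elim: n => //= [] [|n] //= ->; rewrite andbT /rcat /linv xpair_eqE /= eqxx.
by case: b.
Qed.

Lemma zexp_free (e : int) : A zi ^ e = 1 -> e = 0.
Proof.
rewrite -ev_zword => /Afree; rewrite red_id ?zword_sorted // /zword.
by move/(congr1 size); rewrite size_nseq => /eqP; rewrite absz_eq0 => /eqP.
Qed.

(** Reduced words of the [g_i] and powers of [z] concatenate to a reduced word, because letters
    meeting at a junction belong to different generators and no piece is empty. *)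
Lemma zprod_word l :
    {in l, forall p, [/\ zfree p.1, p.1 != 1 & p.2 != 0]} ->
  exists W : word, [/\ sorted rcat W, ev A W = zprod (A zi) l,
    (if W is x :: _ then x.1 != zi else true) & l <> [::] -> W <> [::]].
Proof.
elim: l => [|[g e] l IH] hl; first by exists [::]; rewrite ev_nil zprod_nil.
have [|W [srt EW hW _]] := IH.
  by move=> p pl; apply: hl; rewrite inE pl orbT.
have [] := hl _ (mem_head _ _); move=> /= [w wf ->] g1 e0; move: g1.
rewrite -(ev_red Aunit w).
have := red_all wf; case/lastP: (red w) (red_sorted w) => [|y x] sy fy; first by rewrite ev_nil eqxx.
move=> _; exists (rcons y x ++ zword e ++ W); split.
- apply: rcat_sorted_cat => //.
    apply: rcat_sorted_cat => //; first exact: zword_sorted.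
    move=> u' x' [j b] v' Eu Ev; move: hW; rewrite Ev /= => hj.
    have : x' \in zword e by rewrite Eu mem_rcons mem_head.
    rewrite /zword mem_nseq => /andP[_ /eqP ->].
    by rewrite /rcat xpair_eqE negb_and hj.
  move=> u' [j b] y' v' /rcons_inj [_ <-].
  have : x.1 != zi by move: fy; rewrite /zfree_word all_rcons => /andP[].
  case: x {sy fy} => i c /= ci; rewrite /zword.
  case: `|e|%N (absz_eq0 e) e0 => [<- //|m _ _ /= [<- _]].
  by rewrite /rcat xpair_eqE negb_and eq_sym ci.
- by rewrite !ev_cat EW zprod_cons ev_zword /= ?mulrA.
- by move: fy; rewrite /zfree_word; case: y {sy} => /= [|a y] /andP[].
- by case: y {sy fy}.
Qed.

Lemma free_counting (l : seq (R * int)) : l <> [::] ->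
  {in l, forall p, zfree p.1 /\ p.2 != 0} -> zprod (A zi) l = 1 ->
  balanced l.
Proof.
apply: counting => //.
- by move=> _ [w _ ->]; apply: ev_unit.
- move=> _ _ [u fu ->] [v fv ->]; exists (u ++ v); last by rewrite ev_cat.
  by rewrite /zfree_word all_cat; apply/andP.
- exact: zexp_free.
move=> {}l l0 hl E; have [W [srt EW _ /(_ l0)]] := zprod_word hl.
by apply; rewrite -(red_id srt); apply: Afree; rewrite EW.
Qed.

End FreeNF.

(** * Eight matrices for a word equation *)

Inductive tok := TM of bool * bool | TD of bool | TG | TZ.
Inductive kind := KG | KM | KZ.
Definition item := (kind * seq (bool * bool) * seq bool)%type.

Definition kindG (it : item) := if it.1.1 is KG then true else false.
Definition kindZ (it : item) := if it.1.1 is KZ then true else false.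

(* Every word of tokens is a run of [TD], a list of items and a run of [TM]; an
   item is a run of [TM], then a [TG], a [TZ] or nothing, then a run of [TD]. *)
Definition parse_step (t : tok) (st : seq bool * seq item * seq (bool * bool)) :=
  let: (xs, its, tl) := st in
  match t with
  | TD x => (x :: xs, its, tl)
  | TG => ([::], (KG, [::], xs) :: its, tl)
  | TZ => ([::], (KZ, [::], xs) :: its, tl)
  | TM m => if xs is [::] then
              if its is (k, ws, ys) :: its' then ([::], (k, m :: ws, ys) :: its', tl)
              else ([::], [::], m :: tl)
            else ([::], (KM, [:: m], xs) :: its, tl)
  end.
Definition parse (W : seq tok) := foldr parse_step ([::], [::], [::]) W.

Definition item_ok (it : item) :=
  if it.1.1 is KM then (it.1.2 != [::]) && (it.2 != [::]) else true.

Lemma parse_ok W : all item_ok (parse W).1.2.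
Proof.
elim: W => //= t W; case: (parse W) => [[xs its] tl] /= ok.
case: t => [m|x||] //=; case: xs => [|x xs] //=.
by case: its ok => [|[[[] ws] ys] its] //= /andP[]; rewrite /item_ok //= => /andP[_ ->].
Qed.

Definition notD (t : tok) := if t is TD _ then false else true.

Lemma parse_notD t W : notD t -> (parse (t :: W)).1.1 = [::].
Proof.
case: t => //= [m||] _; case: (parse W) => [[xs its] tl] //=.
by case: xs => //=; case: its => [|[[k ws] ys] its].
Qed.

Lemma tok_split W :
  (exists xs, W = map TD xs) \/ (exists xs t W', W = map TD xs ++ t :: W' /\ notD t).
Proof.
elim: W => [|t W IH]; first by left; exists [::].
case nt: (notD t); first by right; exists [::], t, W.
case: t nt => // x _; case: IH => [[xs ->]|[xs [t [W' [-> nt]]]]].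
  by left; exists (x :: xs).
by right; exists (x :: xs), t, W'.
Qed.

Lemma has_ex (T : Type) (p : pred T) l : has p l -> exists x, p x.
Proof. by elim: l => //= x l IH /orP[px|/IH //]; exists x. Qed.

(** * Counting failures in one block *)

Section Component.
Local Open Scope ring_scope.
Variables (R : unitRingType) (A : nat -> R) (zi : nat).
Hypothesis Aunit : forall i, A i \is a GRing.unit.
Hypothesis Afree : free_family A.
Variables (Y : bool * bool -> R) (X : bool -> R) (g : R).
Let z := A zi.

(* For [TD] the conjugation by [z] makes a [TG] between a run of [TM] and a run
   of [TD] contribute a single [z], to the right of both runs. *)
Definition tokv (t : tok) : R :=
  match t with
  | TM m => Y m
  | TD x => z^-1 * X x * z
  | TG => g * z
  | TZ => z ^ (- 4)
  end.

Definition Yp (ws : seq (bool * bool)) : R := \prod_(m <- ws) Y m.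
Definition Xp (xs : seq bool) : R := \prod_(x <- xs) X x.
Definition kindv (k : kind) : R :=
  match k with KG => g * z | KM => 1 | KZ => z ^ (- 4) end.
Definition itemv (it : item) : R := Yp it.1.2 * kindv it.1.1 * (z^-1 * Xp it.2 * z).
(** The [z^-1] that opens a run of [TD] merges with the power before it: it cancels the [z] of a
    [TG], turns the -4 of a [TZ] into -5, and stands alone in a [KM] item. *)
Definition itemz (it : item) : seq (R * int) :=
  let: (k, ws, xs) := it in
  match k with
  | KG => [:: (Yp ws * g * Xp xs, 1)]
  | KM => [:: (Yp ws, - 1); (Xp xs, 1)]
  | KZ => if xs is [::] then [:: (Yp ws, - 4)] else [:: (Yp ws, - 5); (Xp xs, 1)]
  end.

Lemma Yp_cat u v : Yp (u ++ v) = Yp u * Yp v. Proof. exact: big_cat. Qed.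

Lemma zu : z \is a GRing.unit. Proof. exact: Aunit. Qed.
Hint Resolve zu : core.

Lemma tokv_parse W : \prod_(t <- W) tokv t =
  z^-1 * Xp (parse W).1.1 * z * \prod_(it <- (parse W).1.2) itemv it * Yp (parse W).2.
Proof.
elim: W => [|t W IH]; first by rewrite /Xp /Yp !big_nil !mulr1 mulVr.
rewrite big_cons IH /=; case: (parse W) => [[xs its] tl] /=.
have X1 : z^-1 * Xp [::] * z = 1 by rewrite /Xp big_nil mulr1 mulVr.
have Y1 : Yp [::] = 1 by rewrite /Yp big_nil.
case: t => [m|x||] /=.
- case: xs => [|x xs]; last first.
    by rewrite X1 mul1r big_cons /itemv /= /Yp big_seq1 mulr1 !mulrA.
  rewrite X1 mul1r; case: its => [|[[k ws] ys] its]; rewrite X1.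
    by rewrite !big_nil !mul1r /Yp big_cons.
  by rewrite !big_cons /itemv /= /Yp big_cons mul1r !mulrA.
- rewrite /Xp big_cons -!mulrA; do 2!congr (_ * _).
  by rewrite mulVKr.
- by rewrite X1 mul1r big_cons /itemv /= Y1 mul1r !mulrA.
- by rewrite X1 mul1r big_cons /itemv /= Y1 mul1r !mulrA.
Qed.

Lemma itemzE it : zprod z (itemz it) = itemv it.
Proof.
case: it => [[[] ws] xs]; rewrite /itemv /= ?zprod_cons ?zprod_nil /=.
- by rewrite expr1z mulr1 !mulrA mulrK.
- by rewrite expr1z exprN1 !mulr1 !mulrA.
case: xs => [|x xs]; rewrite !zprod_cons zprod_nil /=.
  by rewrite /Xp big_nil !mulr1 mulVr // mulr1.
have -> : z ^ (- 5) = z ^ (- 4) * z^-1 by rewrite -exprN1 -exprzDr.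
by rewrite expr1z mulr1 !mulrA.
Qed.

Lemma prod_itemz its : \prod_(it <- its) itemv it = zprod z (flatten (map itemz its)).
Proof.
elim: its => [|it its IH]; first by rewrite big_nil /= zprod_nil.
by rewrite big_cons IH /= zprod_cat itemzE.
Qed.

Lemma tokv_TD xs : \prod_(t <- map TD xs) tokv t = z^-1 * Xp xs * z.
Proof.
elim: xs => [|x xs IH]; first by rewrite /Xp !big_nil mulr1 mulVr.
by rewrite /= !big_cons IH /Xp big_cons /= -!mulrA; do 2!congr (_ * _); rewrite mulVKr.
Qed.

Hypothesis Yfree : forall m, zfree A zi (Y m).
Hypothesis Xfree : forall x, zfree A zi (X x).
Hypothesis gfree : zfree A zi g.
Hypothesis Yp1 : forall ws, ws != [::] -> Yp ws != 1.
Hypothesis Xp1 : forall xs, xs != [::] -> Xp xs != 1.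

Lemma zfreeM x y : zfree A zi x -> zfree A zi y -> zfree A zi (x * y).
Proof.
move=> [u fu ->] [v fv ->]; exists (u ++ v); last by rewrite ev_cat.
by rewrite /zfree_word all_cat; apply/andP.
Qed.

Lemma zfree_prod (T : Type) (f : T -> R) (s : seq T) :
  (forall t, zfree A zi (f t)) -> zfree A zi (\prod_(t <- s) f t).
Proof.
move=> hf; elim: s => [|t s IH]; first by exists [::]; rewrite // big_nil ev_nil.
by rewrite big_cons; apply: zfreeM.
Qed.

Definition badG (it : item) := kindG it && (Yp it.1.2 * g * Xp it.2 != 1%R).

Lemma tokv_unit t : tokv t \is a GRing.unit.
Proof.
have fu x : zfree A zi x -> x \is a GRing.unit by case=> w _ ->; apply: ev_unit.
case: t => [m|x||] /=; last exact: unitrXz.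
- exact: fu.
- by rewrite !unitrMl ?unitrV // fu.
- by rewrite unitrMl // fu.
Qed.

Lemma tokv_prod_unit W : \prod_(t <- W) tokv t \is a GRing.unit.
Proof. by elim: W => [|t W IH]; rewrite ?big_nil ?unitr1 // big_cons unitrMl ?tokv_unit. Qed.

(** Negative exponents come only from [KM] and [KZ] items, one from each. A [KM] item offsets its
    own by two nontrivial factors, so [balanced] bounds the failing [KG] items by twice the number
    of [KZ] items, less two. *)
Lemma items_counting its : its <> [::] -> all item_ok its ->
    \prod_(it <- its) itemv it = 1 ->
  count kindG its = (4 * count kindZ its)%N /\
  (count badG its + 2
     <= 2 * count kindZ its)%N.
Proof.
move=> its0 ok; rewrite prod_itemz => E.
have := free_counting Aunit Afree (zi := zi) _ _ E.
have Ys ws : zfree A zi (Yp ws) by apply: zfree_prod.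
have Xs xs : zfree A zi (Xp xs) by apply: zfree_prod.
case.
- by case: its its0 {ok E} => [//|[[[] ws] [|x xs]] its].
- elim: its ok {its0 E} => [|it its IH] //= /andP[_ ok] p; rewrite mem_cat => /orP[|/(IH ok) //].
  case: it => [[[] ws] xs] /=.
  + by rewrite inE => /eqP -> /=; split => //; do 2?apply: zfreeM.
  + by rewrite !inE => /orP[] /eqP -> /=.
  case: xs => [|x xs]; rewrite !inE; first by move=> /eqP -> /=; split.
  by case/orP => /eqP -> /=; split.
have main : \sum_(p <- flatten (map itemz its)) p.2 =
      (count kindG its)%:Z - (4 * count kindZ its)%N%:Z /\
    (count badG its +
     2 * count (fun p : R * int => p.2 < 0)%R (flatten (map itemz its)) <=
     count (fun p : R * int => p.1 != 1%R) (flatten (map itemz its)) + 2 * count kindZ its)%N.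
  elim: its ok {its0 E} => [_ |it its IH /= /andP[oki /IH [IH1 IH2]]]; first by rewrite big_nil.
  rewrite big_cat IH1 !count_cat.
  case: it oki => [[[] ws] xs]; rewrite /item_ok /=.
  - move=> _; split; first by rewrite big_seq1 /=; lia.
    by move: IH2; rewrite /badG /kindG /kindZ /=; case: (_ != 1) => /=; lia.
  - move=> /andP[/Yp1 y1 /Xp1 x1]; split; first by rewrite !big_cons big_nil /=; lia.
    by move: IH2; rewrite /badG /kindG /kindZ /= x1 y1 /=; lia.
  case: xs => [|x xs] _; (split; first by rewrite !big_cons big_nil /=; lia).
    by move: IH2; rewrite /badG /kindG /kindZ /=; case: (_ != 1) => /=; lia.
  have x1 : Xp (x :: xs) != 1 by apply: Xp1.
  by move: IH2; rewrite /badG /kindG /kindZ /= x1; case: (_ != 1) => /=; lia.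
move=> S C; move: main => [S' C']; move: S; rewrite S' => S.
split; first by apply/eqP; rewrite -eqz_nat -subr_eq0 S.
have C2 (a b n m : nat) : (a + 2 * n <= b + 2 * m -> b + 2 <= 2 * n -> a + 2 <= 2 * m)%N by lia.
exact: C2 C' C.
Qed.

(** Rotating the trailing run of [TM] to the front, where the first item absorbs it, closes the word
    into a cycle of items. Without any item the word would be a nonempty run of [TM], which is not
    1. *)
Lemma parse_items W t : notD t -> \prod_(u <- t :: W) tokv u = 1 ->
  exists k ws xs its, (parse (t :: W)).1.2 = (k, ws, xs) :: its /\
    \prod_(it <- (k, (parse (t :: W)).2 ++ ws, xs) :: its) itemv it = 1.
Proof.
move=> nD; rewrite tokv_parse => E.
move: (parse_notD W nD) (E).
have tl0 : (parse (t :: W)).1.2 = [::] -> (parse (t :: W)).2 != [::].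
  case: t nD {E} => //= [m||] _; case: (parse W) => [[xs its] tl] //=.
  by case: xs => //=; case: its => [|[[k ws] ys] its].
move: tl0; case: (parse (t :: W)) => [[xs its] tl] /= + ->.
case: its => [/(_ erefl) tl0 | [[k ws] xs'] its _].
  by rewrite /Xp !big_nil !mulr1 mulVr // !mul1r => F; have := Yp1 tl0; rewrite F eqxx.
rewrite /Xp big_nil mulr1 mulVr // mul1r => F; exists k, ws, xs', its; split => //.
move: F; rewrite !big_cons /itemv /= Yp_cat => F; rewrite -!mulrA.
apply: unitr1C; first by case: (zfree_prod tl Yfree) => w _; rewrite -/(Yp tl) => ->; apply: ev_unit.
by move: F; rewrite !mulrA.
Qed.

End Component.

(** * Both blocks together: the word equation *)

Section EightMatrices.
Local Open Scope ring_scope.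
Variable A : nat -> 'M[int]_2.
Hypothesis Aunit : forall i, A i \is a GRing.unit.
Hypothesis Afree : free_family A.
Variables (h : bool * bool -> seq nat) (cd : bool -> seq nat) (s e : 'M[int]_2).
Hypothesis h0 : forall m, h m <> [::].
Hypothesis c0 : forall x, cd x <> [::].
Hypothesis h3 : forall m, 3 \notin h m.
Hypothesis c3 : forall x, 3 \notin cd x.
Hypothesis s3 : zfree A 3 s.
Hypothesis e3 : zfree A 3 e.

Definition lett (x : bool) : nat := if x then 2 else 1.
Definition Y1 (m : bool * bool) : 'M[int]_2 := X (lett m.2).
Definition Z1 (x : bool) : 'M[int]_2 := (X (lett x))^-1.
Definition Y2 (m : bool * bool) : 'M[int]_2 := s * ev A (pos (h m)) * s^-1.
Definition Z2 (x : bool) : 'M[int]_2 := (ev A (pos (cd x)))^-1.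

Definition tok1 : tok -> 'M[int]_2 := tokv X 3 Y1 Z1 1.
Definition tok2 : tok -> 'M[int]_2 := tokv A 3 Y2 Z2 (s * e).

Lemma Z1p xs : Xp Z1 xs = (ev X (pos (map lett (rev xs))))^-1.
Proof.
elim: xs => [|x xs IH]; first by rewrite /Xp big_nil ev_nil invr1.
rewrite /Xp big_cons -/(Xp Z1 xs) IH rev_cons map_rcons -cats1 pos_cat ev_cat.
by rewrite invrM ?ev_unit ?X_unit //; [rewrite ev_cons ev_nil mulr1 | exact: X_unit..].
Qed.

Lemma Y1p ws : Yp Y1 ws = ev X (pos (map lett (map snd ws))).
Proof.
elim: ws => [|x ws IH]; first by rewrite /Yp big_nil ev_nil.
by rewrite /Yp big_cons -/(Yp Y1 ws) IH /= ev_cons.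
Qed.

Lemma su : s \is a GRing.unit. Proof. by case: s3 => w _ ->; apply: ev_unit. Qed.
Lemma eu : e \is a GRing.unit. Proof. by case: e3 => w _ ->; apply: ev_unit. Qed.
Hint Resolve su eu : core.

Lemma Z2p xs : Xp Z2 xs = (ev A (pos (flatten (map cd (rev xs)))))^-1.
Proof.
elim: xs => [|x xs IH]; first by rewrite /Xp big_nil ev_nil invr1.
rewrite /Xp big_cons -/(Xp Z2 xs) IH rev_cons map_rcons flatten_rcons pos_cat ev_cat.
by rewrite invrM ?ev_unit.
Qed.

Lemma Y2p ws : Yp Y2 ws = s * ev A (pos (flatten (map h ws))) * s^-1.
Proof.
elim: ws => [|x ws IH]; first by rewrite /Yp big_nil ev_nil mulr1 mulrV.
rewrite /Yp big_cons -/(Yp Y2 ws) IH /= pos_cat ev_cat /Y2.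
by rewrite !mulrA mulrVK.
Qed.

Lemma pos_zfree u : (3 \notin u)%N -> zfree A 3 (ev A (pos u)).
Proof.
move=> u3; exists (pos u) => //; rewrite /zfree_word all_map; apply/allP => x xu /=.
by apply: contraNneq u3 => <-.
Qed.

Lemma zfreeV x : zfree A 3 x -> zfree A 3 x^-1.
Proof.
move=> [w fw ->]; exists (winv w); last by rewrite ev_winv.
by rewrite /zfree_word all_rev all_map.
Qed.

Lemma unit_conj1 (x y : 'M[int]_2) : x \is a GRing.unit -> x * y * x^-1 = 1 -> y = 1.
Proof.
by move=> ux E; rewrite -(mulKr ux y) -[x * y](mulrVK ux) E mul1r mulVr.
Qed.

Lemma flatten_ne (T : eqType) (f : T -> seq nat) (l : seq T) :
  (forall x, f x <> [::]) -> l != [::] -> flatten (map f l) <> [::].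
Proof. by move=> hf; case: l => //= x l _; case: (f x) (hf x). Qed.

Lemma ev_pos1 (B : nat -> 'M[int]_2) u : free_family B -> ev B (pos u) = 1 -> u = [::].
Proof. by move=> Bf /Bf; rewrite red_id ?pos_sorted //; case: u. Qed.

(** At a [TG] that succeeds in both blocks, the first block makes the run of [TD] the reverse of the
    letters of the run of [TM], and the second is then the equation. Conversely, a solution gives a
    token word with value [z] in each block, whose fourth power cancels a [TZ]. *)
Lemma tokens_identity :
  (exists W, [/\ W <> [::], \prod_(t <- W) tok1 t = 1 & \prod_(t <- W) tok2 t = 1]) <->
  exists w : seq (bool * bool),
    s * ev A (pos (flatten (map h w))) * e = ev A (pos (flatten (map cd (map snd w)))).
Proof.
have Z1ne xs : xs != [::] -> Xp Z1 xs != 1.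
  rewrite Z1p => xs0; apply/negP => /eqP/(congr1 (fun x => x^-1)).
  rewrite invr1 invrK => /(ev_pos1 X_free)/(congr1 size).
  by rewrite size_map size_rev => /size0nil E; rewrite E in xs0.
have Y1ne ws : ws != [::] -> Yp Y1 ws != 1.
  rewrite Y1p => ws0; apply/negP => /eqP/(ev_pos1 X_free)/(congr1 size).
  by rewrite !size_map => /size0nil E; rewrite E in ws0.
have Z2ne xs : xs != [::] -> Xp Z2 xs != 1.
  rewrite Z2p => xs0; apply/negP => /eqP/(congr1 (fun x => x^-1)).
  rewrite invr1 invrK => /(ev_pos1 Afree); apply: flatten_ne c0 _.
  by rewrite -size_eq0 size_rev size_eq0.
have Y2ne ws : ws != [::] -> Yp Y2 ws != 1.
  rewrite Y2p => ws0; apply/negP => /eqP/(unit_conj1 su)/(ev_pos1 Afree).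
  exact: flatten_ne h0 _.
split => [[W [W0 E1 E2]] | [w E]]; last first.
  pose B := map TM w ++ TG :: map TD (rev (map snd w)).
  have Dp (C : nat -> 'M[int]_2) Y V g : (forall i, C i \is a GRing.unit) ->
      \prod_(t <- B) tokv C 3 Y V g t =
      Yp Y w * g * Xp V (rev (map snd w)) * C 3.
    move=> Cu; rewrite big_cat big_cons big_map -/(Yp Y w) /= -!mulrA; do 2!congr (_ * _).
    by rewrite tokv_TD // -mulrA mulVKr.
  have Q1 : \prod_(t <- B) tok1 t = X 3.
    rewrite Dp ?mulr1; last exact: X_unit.
    by rewrite Y1p Z1p revK mulrV ?mul1r // ev_unit //; exact: X_unit.
  have Q2 : \prod_(t <- B) tok2 t = A 3.
    rewrite Dp // Y2p Z2p revK -E -[_ * s^-1 * _]mulrA mulKr //.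
    by rewrite mulrV ?mul1r // !unitrMl // ev_unit.
  have rep C (v : tok -> 'M[int]_2) c : \prod_(t <- C) v t = c -> c \is a GRing.unit ->
      v TZ = c ^ (- 4) -> \prod_(t <- C ++ C ++ C ++ C ++ [:: TZ]) v t = 1.
    move=> Bc cu vZ; rewrite !big_cat Bc big_seq1 /= vZ.
    have -> : c ^ (- 4) = c^-1 * c^-1 * c^-1 * c^-1 by rewrite -!exprN1 -!exprzDr.
    by rewrite !mulrA !mulrK // mulrV.
  exists (B ++ B ++ B ++ B ++ [:: TZ]); split.
  - by rewrite /B; case: w {E B Dp Q1 Q2 rep}.
  - by apply: rep Q1 _ _ => //; exact: X_unit.
  - exact: rep Q2 _ _.
have Y1f m : zfree X 3 (Y1 m).
  by exists [:: (lett m.2, true)]; [case: m => [? []] | rewrite ev_cons ev_nil mulr1].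
have Z1f x : zfree X 3 (Z1 x).
  by exists [:: (lett x, false)]; [case: x | rewrite ev_cons ev_nil mulr1].
have g1f : zfree X 3 1 by exists [::]; rewrite ?ev_nil.
have Y2f m : zfree A 3 (Y2 m) by apply: zfreeM; [apply: zfreeM => //; exact: pos_zfree | exact: zfreeV].
have Z2f x : zfree A 3 (Z2 x) by apply: zfreeV; exact: pos_zfree.
have gf : zfree A 3 (s * e) by apply: zfreeM.
(* A nonempty word of [TD] alone is not 1 in the first block, so some rotation starts with another
   token. *)
have [t [W' [nt E1' E2']]] : exists t W', [/\ notD t,
    \prod_(u <- t :: W') tok1 u = 1 & \prod_(u <- t :: W') tok2 u = 1].
  have [[xs EW]|[xs [t [W' [EW nt]]]]] := tok_split W.
    move: E1; rewrite EW tokv_TD; last exact: X_unit.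
    rewrite -{2}[X 3]invrK => /unit_conj1; rewrite unitrV X_unit => /(_ isT) E1.
    have : xs != [::] by apply/eqP => xs0; apply: W0; rewrite EW xs0.
    by move/Z1ne; rewrite E1 eqxx.
  exists t, (W' ++ map TD xs); split => //.
    by rewrite -cat_cons big_cat; apply: unitr1C; [apply: tokv_prod_unit => //; exact: X_unit | rewrite -big_cat -EW].
  by rewrite -cat_cons big_cat; apply: unitr1C; [apply: tokv_prod_unit | rewrite -big_cat -EW].
have [k [ws [xs [its [Ep P1]]]]] := parse_items X_unit Y1f Y1ne nt E1'.
have [k' [ws' [xs' [its' [Ep' P2]]]]] := parse_items Aunit Y2f Y2ne nt E2'.
move: Ep' P2; rewrite Ep => [[<- <- <- <-]] P2 {k' ws' xs' its'}.
move: P1 P2; set its2 := _ :: its => P1 P2.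
have ok : all item_ok its2.
  have := parse_ok (t :: W'); rewrite Ep /= => /andP[oki ->]; rewrite andbT.
  by move: oki; rewrite /item_ok /=; case: k {Ep its2 P1 P2} => // /andP[w0 ->]; rewrite andbT; case: (_.2) => //.
have its20 : its2 <> [::] by [].
have [n1 c1] := items_counting X_unit X_free Y1f Z1f g1f Y1ne Z1ne its20 ok P1.
have [_ c2] := items_counting Aunit Afree Y2f Z2f gf Y2ne Z2ne its20 ok P2.
(* Together the two blocks allow at most [4 count kindZ - 4] failures among [4 count kindZ] items
   with a [TG]. *)
have : has (fun it => [&& kindG it, ~~ badG Y1 Z1 1 it & ~~ badG Y2 Z2 (s * e) it]) its2.
  rewrite has_count; move: n1 c1 c2; move: (its2) => l {its20 ok P1 P2}.
  suff : (count kindG l <= count (badG Y1 Z1 1) l + count (badG Y2 Z2 (s * e)) l +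
     count (fun it => [&& kindG it, ~~ badG Y1 Z1 1 it & ~~ badG Y2 Z2 (s * e) it]) l)%N by lia.
  elim: l => //= it l IH; case: (kindG it) => /=; case: (badG _ _ _ it); case: (badG _ _ _ it) => /=; lia.
case/has_ex => [[[[] ws'] xs'] /and3P[]] //= _; rewrite /badG /= !negbK => /eqP G1 /eqP G2.
exists ws'.
have <- : rev xs' = map snd ws'.
  apply: (inj_map (f := lett)); first by case; case.
  apply: (ev_pos_inj X_unit X_free); move: G1; rewrite mulr1 Y1p Z1p => G1.
  by rewrite -[LHS]mul1r -G1 mulrVK // ev_unit //; exact: X_unit.
move: G2; rewrite Y2p Z2p -!mulrA mulKr // !mulrA => G2.
by rewrite -[RHS]mul1r -G2 mulrVK // ev_unit.
Qed.

End EightMatrices.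

(** * Matrices with quadratic entries *)

Local Open Scope ring_scope.

Section TwistedFamily.
Variables (u v : word).
Hypothesis u0 : all (fun x => x.1 != 0%N) u.
Hypothesis v0 : all (fun x => x.1 != 0%N) v.

(* Replacing one generator by [u X_0 v], with [u] and [v] in the others, keeps
   the family free: this is an automorphism of the free group. *)
Definition twist (a b : word) (i : nat) : 'M[int]_2 :=
  if i == 0%N then ev X a * X 0 * ev X b else X i.

Lemma twist_unit a b i : twist a b i \is a GRing.unit.
Proof.
have Xu := X_unit; rewrite /twist; case: eqP => // _.
by rewrite !unitrMl ?ev_unit.
Qed.

Lemma ev_twist0 a b w : all (fun x => x.1 != 0%N) w -> ev (twist a b) w = ev X w.
Proof.
elim: w => [|[i e] w IH] /=; first by rewrite !ev_nil.
by case/andP=> i0 /IH E; rewrite !ev_cons E /lev /twist /= (negbTE i0).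
Qed.

(** [sg] substitutes [u 0 v] for 0. If [w] is trivial under the twist, then its image under [sg] is
    freely trivial, hence also 1 under the inverse twist, where [u 0 v] evaluates to [X 0]; so [w]
    is trivial in the original family. *)
Lemma twist_free : free_family (twist u v).
Proof.
pose sg (x : nat * bool) : word := if x.1 == 0%N then
  (if x.2 then u ++ (0%N, true) :: v else winv (u ++ (0%N, true) :: v)) else [:: x].
have Xu := X_unit.
have sgE a b (c : 'M[int]_2) w : ev (twist a b) (u ++ (0%N, true) :: v) = c ->
    ev (twist a b) (flatten (map sg w)) =
    ev (fun i => if i == 0%N then c else X i) w.
  have Tu := twist_unit a b.
  move=> Ec; elim: w => [|[i e] w IH]; first by rewrite !ev_nil.
  rewrite /= ev_cat IH [in RHS]ev_cons; congr (_ * _).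
  rewrite /sg /lev /=; case: eqP => [_|/eqP i0].
    by case: e; rewrite ?ev_winv ?Ec.
  by rewrite ev_cons ev_nil mulr1 /lev /= /twist (negbTE i0).
move=> w Ew.
have id0 : forall i, twist [::] [::] i = X i.
  by case=> [|i]; rewrite /twist //= !ev_nil mulr1 mul1r.
have evid w' : ev (twist [::] [::]) w' = ev X w'.
  by elim: w' => [|x w' IH]; rewrite ?ev_nil // !ev_cons IH /lev id0.
have E1 : ev X (flatten (map sg w)) = 1.
  rewrite -evid (sgE _ _ (twist u v 0)); last by rewrite evid ev_cat ev_cons mulrA.
  rewrite -[RHS]Ew; elim: (w) => [|x w' IH]; rewrite ?ev_nil // !ev_cons IH; congr (_ * _).
have := red_nil_ev (twist_unit (winv u) (winv v)) (X_free E1).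
rewrite (sgE _ _ (X 0)).
  move=> E2; apply: X_free; rewrite -[RHS]E2; elim: (w) => [|x w' IH]; rewrite ?ev_nil // !ev_cons IH.
  by congr (_ * _); rewrite /lev; case: x => [[|i] e].
rewrite ev_cat ev_cons !ev_twist0 // {1}/lev /twist /= !ev_winv //.
by rewrite !mulrA mulrV ?ev_unit // mul1r mulrVK ?ev_unit.
Qed.

End TwistedFamily.

Section Determinants.

Definition unimodular n (M : 'M[int]_n) : Prop := \det M = 1.

Lemma det1M (M N : 'M[int]_2) : unimodular M -> unimodular N -> unimodular (M * N).
Proof. by rewrite /unimodular => m1 n1; rewrite det_mulmx m1 n1 mulr1. Qed.

Lemma det1V (M : 'M[int]_2) : unimodular M -> unimodular M^-1.
Proof. by rewrite /unimodular => m1; rewrite det_inv m1 invr1. Qed.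

Lemma det1_1 : unimodular (1 : 'M[int]_2). Proof. exact: det1. Qed.

Lemma det1_X i : unimodular (X i).
Proof. by rewrite /unimodular mx2_det !mxE /=; ring. Qed.

Lemma det1_ev (A : nat -> 'M[int]_2) w : (forall i, unimodular (A i)) -> unimodular (ev A w).
Proof.
move=> A1; elim: w => [|x w IH]; first by rewrite ev_nil; apply: det1_1.
by rewrite ev_cons; apply: det1M => //; rewrite /lev; case: x.2; [|apply: det1V].
Qed.

Lemma det1_twist u v i : unimodular (twist u v i).
Proof.
rewrite /twist; case: eqP => _; last exact: det1_X.
by do !apply: det1M; [apply: det1_ev|apply: det1_X|apply: det1_ev]; apply: det1_X.
Qed.

Lemma det1_exp4 (z : 'M[int]_2) : unimodular z -> unimodular (z ^ (- 4)).
Proof.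
move=> z1; apply: (@det1V (z ^+ 4)); rewrite !exprS expr0.
by do !apply: det1M => //; apply: det1_1.
Qed.

End Determinants.

(** * Unipotent powers and block matrices *)

Definition shear : 'M[int]_2 := mx2 0 5 0 0.

Lemma shear2 : shear * shear = 0.
Proof. by apply: mx2P; rewrite mx2M !mxE /=; ring. Qed.

Lemma X0_shear : X 0 = 1 + shear.
Proof. by apply: mx2P; rewrite !mxE /=; ring. Qed.

Lemma X0_exp n : X 0 ^+ n = 1 + shear *+ n.
Proof.
elim: n => [|n IH]; first by rewrite expr0 mulr0n addr0.
rewrite exprS IH X0_shear mulrDl mul1r mulrDr mulr1 mulrnAr shear2 mul0rn addr0.
by rewrite -addrA -mulrSr.
Qed.

Lemma X0_expV n : (X 0 ^+ n)^-1 = 1 - shear *+ n.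
Proof.
have u : X 0 ^+ n \is a GRing.unit by rewrite unitrX ?X_unit.
rewrite -[LHS]mulr1 -[RHS](mulKr u); congr (_ * _).
by rewrite X0_exp mulrDl mul1r mulrBr mulr1 mulrnAr mulrnAl shear2 !mul0rn subr0 subrK.
Qed.

Definition quad (V : zmodType) (C : nat -> V) (n : nat) : V :=
  C 0%N + C 1%N *+ n + C 2%N *+ (n * n).

Lemma quad_const (V : zmodType) (c : V) : exists C : nat -> V, forall n, c = quad C n.
Proof.
exists (fun k => if k is 0%N then c else 0) => n.
by rewrite /quad !mul0rn !addr0.
Qed.

Lemma quad_conj (K H K' : 'M[int]_2) : exists C : nat -> 'M[int]_2, forall n,
  K * (1 + shear *+ n) * H * (1 - shear *+ n) * K' = quad C n.
Proof.
exists (fun k => match k with 0%N => K * H * K'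
  | 1%N => K * shear * H * K' - K * H * shear * K'
  | _ => - (K * shear * H * shear * K') end) => n.
rewrite /quad mulrnBl mulNrn mulrnA.
rewrite !(mulrDr, mulrDl, mulr1, mul1r, mulrN, mulNr) !(mulrnAr, mulrnAl).
by rewrite ?mulrnA !addrA.
Qed.

Lemma quad_mul (K H : 'M[int]_2) : exists C : nat -> 'M[int]_2, forall n,
  K * (1 + shear *+ n) * H = quad C n.
Proof.
exists (fun k => match k with 0%N => K * H | 1%N => K * shear * H | _ => 0 end) => n.
by rewrite /quad mul0rn addr0 mulrDr mulrDl mulr1 mulrnAr mulrnAl.
Qed.

Definition diag_block (M N : 'M[int]_2) : 'M[int]_4 := (block_mx M 0 0 N : 'M_(2 + 2)).

Lemma diag_block1 : diag_block 1 1 = 1.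
Proof. by symmetry; apply: (@scalar_mx_block _ 2 2 1). Qed.

Lemma diag_blockM M N M' N' :
  diag_block M N * diag_block M' N' = diag_block (M * M') (N * N').
Proof.
apply: etrans (@mulmx_block _ 2 2 2 2 2 2 M 0 0 N M' 0 0 N') _.
by rewrite !mulmx0 !mul0mx !addr0 !add0r.
Qed.

Lemma diag_block_inj M N M' N' : diag_block M N = diag_block M' N' -> M = M' /\ N = N'.
Proof. by move=> E; have [] := @eq_block_mx _ 2 2 2 2 _ _ _ _ _ _ _ _ E. Qed.

Lemma diag_block_det M N : unimodular M -> unimodular N -> unimodular (diag_block M N).
Proof. by rewrite /unimodular => m1 n1; rewrite (@det_ublock _ 2 2) m1 n1 mulr1. Qed.

Lemma quad_block M (C : nat -> 'M[int]_2) : exists D : nat -> 'M[int]_4, forall n,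
  diag_block M (quad C n) = quad D n.
Proof.
exists (fun k => diag_block (if k is 0%N then M else 0) (C k)) => n.
have add P Q P' Q' : diag_block P Q + diag_block P' Q' = diag_block (P + P') (Q + Q').
  by rewrite /diag_block -[LHS]/(block_mx P 0 0 Q + block_mx P' 0 0 Q') add_block_mx !addr0.
have muln P Q m : diag_block P Q *+ m = diag_block (P *+ m) (Q *+ m).
  elim: m => [|m IH]; last by rewrite !mulrS IH add.
  by rewrite !mulr0n /diag_block; symmetry; apply: (@block_mx_const _ 2 2 2 2 0).
by rewrite /quad !muln !add !mul0rn !addr0.
Qed.

Definition toks : seq tok := [:: TM (false, false); TM (false, true); TM (true, false);
  TM (true, true); TD false; TD true; TG; TZ].
Definition tok_of (i : 'I_8) : tok := nth TZ toks i.

Lemma tok_ofP t : exists i, tok_of i = t.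
Proof.
have [k [k8 <-]] : exists k, (k < 8)%N /\ nth TZ toks k = t.
  by case: t => [[[] []]|[]||]; [exists 3 | exists 2 | exists 1 | exists 0%N | exists 5 | exists 4 | exists 6 | exists 7].
by exists (Ordinal k8).
Qed.

Lemma semigroup_tokens (v1 v2 : tok -> 'M[int]_2) :
  in_semigroup [tuple diag_block (v1 (tok_of i)) (v2 (tok_of i)) | i < 8] 1%:M <->
  exists W, [/\ W <> [::], \prod_(t <- W) v1 t = 1 & \prod_(t <- W) v2 t = 1].
Proof.
have prodE W : \prod_(t <- W) diag_block (v1 t) (v2 t) =
    diag_block (\prod_(t <- W) v1 t) (\prod_(t <- W) v2 t).
  elim: W => [|t W IH]; first by rewrite !big_nil diag_block1.
  by rewrite !big_cons IH diag_blockM.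
split=> [[w [w0 ws E]] | [W [W0 E1 E2]]].
  have [W EW] : exists W, w = [seq diag_block (v1 t) (v2 t) | t <- W].
    elim: w ws {w0 E} => [|M w IH] ws; first by exists [::].
    have [|W ->] := IH; first by move=> N Nw; apply: ws; rewrite inE Nw orbT.
    have /tnthP [i ->] := ws M (mem_head _ _).
    by exists (tok_of i :: W); rewrite tnth_mktuple.
  exists W; move: E; rewrite EW big_map prodE => E.
  have [E1 E2] : \prod_(t <- W) v1 t = 1 /\ \prod_(t <- W) v2 t = 1.
    by apply: diag_block_inj; rewrite diag_block1.
  by split => //; move=> W0; apply: w0; rewrite EW W0.
exists [seq diag_block (v1 t) (v2 t) | t <- W]; split.
- by case: W W0 {E1 E2}.
- move=> M; elim: W {W0 E1 E2} => //= t W IH; rewrite inE => /orP[/eqP -> | /IH //].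
  have [i <-] := tok_ofP t.
  by apply: (map_f (fun i => diag_block (v1 (tok_of i)) (v2 (tok_of i)))); rewrite mem_enum.
by rewrite big_map prodE E1 E2 diag_block1.
Qed.

(** * Undecidability *)

Lemma codes_pos_lt3 jump q : all (fun i => i < 3)%N (codes jump q).
Proof.
elim: q => //= x q IH; rewrite /codes /= all_cat -/(codes jump q) IH andbT all_nseq orbT.
by case: x.
Qed.

Lemma text_lt3 jump c : all (fun i => i < 3)%N (text jump c).
Proof.
case: c => o q; case/lastP: q => [//|q y].
by rewrite text_rcons all_cat codes_pos_lt3 /= all_nseq orbT; case: y.
Qed.

Lemma hrule_lt3 jump bl m : all (fun i => i < 3)%N (hrule jump bl m).
Proof.
by case: m => [[] l] //; rewrite /hrule /= all_cat codes_pos_lt3; case: l.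
Qed.

Lemma lt3_notin u : all (fun i => i < 3)%N u -> 3 \notin u.
Proof. by move=> h; apply/negP => /(allP h). Qed.

Lemma text_codes jump o q y : (o <= (jump y).-1)%N ->
  text jump (o, rcons q y) ++ nseq o 2%N = codes jump (rcons q y).
Proof.
move=> le; rewrite text_rcons -catA /= -nseqD subnK //.
by rewrite -cats1 codes_cat /codes /= cats0.
Qed.

Lemma codes_b0 jump m : all (fun x => x.1 != 0%N) (pos (codes jump (nseq m false))).
Proof.
elim: m => // m IH; rewrite -[codes _ _]/(code jump false ++ codes jump (nseq m false)).
by rewrite pos_cat all_cat IH andbT /pos /code /= map_nseq all_nseq orbT.
Qed.

(** * The matrices attached to one recursive function *)

Section Instance.
Variable f : recfun 1.
Let prog := main_prog f.
Let R := (creg (main_cmd f)).+1.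
Let wfp : all (wf_instr (size prog) R) prog := main_wf f.
Let jump := wjump (wc0 prog R) (wT R) (wbeta prog R).
Let bl := wbl (wc0 prog R) (wT R) (wbeta prog R) (F prog R).
Let c n := cinit prog R n.
Let fn := fin prog R.
Let off := (wA prog R * S0 R)%N.

(* The letter 0 is twisted so that the code of [unitw], one unit of the input,
   evaluates to the unipotent [X 0]: the block [s n] is then affine in [n]. *)
Let pre := pos (codes jump (nseq (unit_pre prog R) false)).
Let post := pos (nseq (jump true).-1 2%N ++ codes jump (nseq (unit_post prog R) false)).
Let A := twist (winv pre) (winv post).

Let pre0 : all (fun x => x.1 != 0%N) pre. Proof. exact: codes_b0. Qed.
Let post0 : all (fun x => x.1 != 0%N) post.
Proof. by rewrite /post pos_cat all_cat codes_b0 andbT /pos map_nseq all_nseq orbT. Qed.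

Let winv0 w : all (fun x => x.1 != 0%N) w -> all (fun x : nat * bool => x.1 != 0%N) (winv w).
Proof. by rewrite /winv all_rev all_map. Qed.

Let Au i : A i \is a GRing.unit. Proof. exact: twist_unit. Qed.
Let Af : free_family A. Proof. by apply: twist_free; apply: winv0. Qed.
Let jump0 l : (0 < jump l)%N. Proof. exact: (wjump0 (wc0_gt0 wfp) (wbetaP prog R)). Qed.

Let ev_unitw : ev A (pos (codes jump (unitw prog R))) = X 0.
Proof.
have Xu := X_unit.
have -> : codes jump (unitw prog R) = codes jump (nseq (unit_pre prog R) false) ++
    0%N :: (nseq (jump true).-1 2%N ++ codes jump (nseq (unit_post prog R) false)).
  by rewrite /unitw codes_cat.
rewrite pos_cat ev_cat -/pre /= ev_cons -/post /A !ev_twist0 // /lev /twist /= !ev_winv //.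
by rewrite !mulrA mulrV ?ev_unit // mul1r mulrVK ?ev_unit.
Qed.

(** Since the last letter is the same for every [n], the start text always lacks [off] fillers of
    the same code. *)
Let cinit_rcons n : exists q, (c n).2 = rcons q false.
Proof.
have [_ h2 _ h4] := unit_bounds wfp isT.
have A0 := wA_gt prog R; have xl : (xh 0 + wc0 prog R < wA prog R)%N.
  by have := wc0_gt0 wfp; rewrite /xh; lia.
have ends m : (0 < m)%N -> exists q, nseq m false = rcons q false.
  by case: m => // m _; exists (nseq m false); rewrite -cats1 -addn1 nseqD.
rewrite /c /cinit /=; case: n => [|n].
  rewrite cats0 /raw /=.
  have [|q ->] := ends ((wT R + 2) * wc0 prog R - (xh 0 + 0 * wc0 prog R + wc0 prog R))%N.
    by rewrite -/(wA prog R); lia.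
  by eexists; rewrite -!rcons_cat.
have -> : flatten (nseq n.+1 (unitw prog R)) = flatten (nseq n (unitw prog R)) ++ unitw prog R.
  by rewrite -addn1 nseqD flatten_cat /= cats0.
have [q Eq] := ends _ h4; rewrite /unitw Eq.
by eexists; rewrite -rcons_cons -!rcons_cat.
Qed.

Let off_lt : (off <= (jump false).-1)%N /\ (wA prog R * S0 R + 1 < jump false)%N.
Proof.
have [h1 _ _ _] := unit_bounds wfp isT.
have h6 : (wA prog R * S0 R + wA prog R * 3 < wbeta prog R)%N by rewrite -mulnDr.
have := wA_gt prog R; have := wc0_gt0 wfp.
by rewrite -[jump false]/(wbeta prog R) /off; split; lia.
Qed.

Let wf_c n : twf jump (c n).
Proof.
have [q Eq] := cinit_rcons n; have [h _] := off_lt.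
rewrite [c n]surjective_pairing Eq twf_rcons -[(c n).1]/off.
by apply: leq_ltn_trans h _; rewrite (prednK (jump0 false)).
Qed.

Let wf_fn : twf jump fn.
Proof. by have [_ h] := off_lt; rewrite /fn /fin /twf /=. Qed.

Let s n := ev A (pos (text jump (c n))).
Let e := (ev A (pos (text jump fn)))^-1.
Let K := ev A (pos (codes jump (raw (wc0 prog R) (wT R) (wbeta prog R) (F prog R) [:: xh 0]))).
Let V := (ev A (pos (nseq off 2%N)))^-1.

(** Supplying the missing fillers turns the text into the code of the whole tape: a fixed part, then
    [n] copies of [unitw], each evaluating to [X 0]. *)
Let sE n : s n = K * (1 + shear *+ n) * V.
Proof.
have [q Eq] := cinit_rcons n; have [h _] := off_lt.
have := text_codes q h; rewrite -Eq -[(off, _)]/(c n) => E.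
have {E}: s n * ev A (pos (nseq off 2%N)) =
      ev A (pos (codes jump (raw (wc0 prog R) (wT R) (wbeta prog R) (F prog R) [:: xh 0] ++
        flatten (nseq n (unitw prog R))))).
  by rewrite -ev_cat -pos_cat E.
rewrite codes_cat pos_cat ev_cat -/K => E.
rewrite -[LHS](mulrK (ev_unit Au (pos (nseq off 2%N)))) E; congr (_ * _ * _).
rewrite -X0_exp; elim: n {Eq E} => [|n IH]; first by rewrite ev_nil.
rewrite -[flatten _]/(unitw prog R ++ flatten (nseq n (unitw prog R))).
by rewrite codes_cat pos_cat ev_cat IH ev_unitw exprS.
Qed.

Let h := hrule jump bl.
Let cd := code jump.

Lemma instance_tokens n :
  (computes f [tuple n] 0 ->
    exists W, [/\ W <> [::], \prod_(t <- W) tok1 t = 1 &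
      \prod_(t <- W) tok2 A h cd (s n) e t = 1]) /\
  (forall y, computes f [tuple n] y.+1 ->
    ~ exists W, [/\ W <> [::], \prod_(t <- W) tok1 t = 1 &
      \prod_(t <- W) tok2 A h cd (s n) e t = 1]).
Proof.
have [halt loop] := counter_tag wfp isT n isT erefl.
have h0 m : h m <> [::] by case: m => [[] l] //; rewrite /h /hrule /=; case: (codes _ _).
have c0 x : cd x <> [::] by [].
have h3 m : 3 \notin h m by apply: lt3_notin; apply: hrule_lt3.
have c3 x : 3 \notin cd x.
  by apply: lt3_notin; have := codes_pos_lt3 jump [:: x]; rewrite -[codes _ _]/(code jump x ++ [::]) cats0.
have s3 : zfree A 3 (s n) by apply: pos_zfree; apply: lt3_notin; apply: text_lt3.
have e3 : zfree A 3 e by apply: (zfreeV Au); apply: pos_zfree; apply: lt3_notin; apply: text_lt3.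
have [to from] := tokens_identity Au Af h0 c0 h3 c3 s3 e3.
have eqE (w : seq (bool * bool)) :
    s n * ev A (pos (flatten (map h w))) * e = ev A (pos (flatten (map cd (map snd w)))) <->
    text jump (c n) ++ hrules jump bl w = codes jump (map snd w) ++ text jump fn.
  split=> [E | E].
    apply: (ev_pos_inj Au Af); rewrite !pos_cat !ev_cat -/(s n).
    by rewrite -[LHS](mulrVK (ev_unit Au (pos (text jump fn)))) -/e E.
  rewrite -ev_cat -pos_cat E pos_cat ev_cat /e mulrK //; exact: ev_unit.
split=> [/main_halt/halt [m Em] | y /main_loop/loop big].
  have [w Ew] := tag_complete jump0 (wf_c n) Em.
  by apply: from; exists w; apply/eqE.
move=> /to [w /eqE Ew].
exact: (tag_sound jump0 (wf_c n) wf_fn erefl big Ew).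
Qed.

(** Degree 2 arises only from the conjugates [Y2], where [s n] meets its inverse; both are affine in
    [n] because [shear] squares to 0. *)
Lemma instance_quad : exists C : 'I_8 -> nat -> 'M[int]_4, forall i n,
  diag_block (tok1 (tok_of i)) (tok2 A h cd (s n) e (tok_of i)) = quad (C i) n.
Proof.
apply: (fin_all_exists (P := fun i (C : nat -> 'M[int]_4) => forall n,
  diag_block (tok1 (tok_of i)) (tok2 A h cd (s n) e (tok_of i)) = quad C n)) => i.
move: (tok_of i) => t.
suff [C EC] : exists C : nat -> 'M[int]_2, forall n, tok2 A h cd (s n) e t = quad C n.
  by have [D ED] := quad_block (tok1 t) C; exists D => n; rewrite EC.
have Ku : K \is a GRing.unit by apply: ev_unit.
have Vu : V \is a GRing.unit by rewrite unitrV ev_unit.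
case: t => [m|x||].
- have [C EC] := quad_conj K (V * ev A (pos (h m)) * V^-1) K^-1.
  exists C => n; rewrite -EC /tok2 /= /Y2.
  have sVE : (s n)^-1 = V^-1 * (1 - shear *+ n) * K^-1.
    have Eu := unitrX n (X_unit 0); rewrite -X0_expV sE -X0_exp.
    have KXu : K * X 0 ^+ n \is a GRing.unit by rewrite unitrMl.
    by rewrite (invrM KXu Vu) (invrM Ku Eu) mulrA.
  by rewrite sVE sE !mulrA.
- exact: quad_const.
- have [C EC] := quad_mul K (V * (e * A 3)).
  by exists C => n; rewrite -EC /tok2 /= sE !mulrA.
exact: quad_const.
Qed.

Lemma instance_det n i :
  \det (diag_block (tok1 (tok_of i)) (tok2 A h cd (s n) e (tok_of i))) = 1.
Proof.
have A1 j : unimodular (A j) by apply: det1_twist.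
have ev1 w : unimodular (ev A w) by apply: det1_ev.
have s1 : unimodular (s n) by exact: ev1.
have e1 : unimodular e by exact: (det1V (ev1 _)).
have X1 := det1_X.
have D (x y : 'M[int]_2) : unimodular x -> unimodular y -> unimodular (x^-1 * y * x).
  by move=> x1 y1; apply: det1M => //; apply: det1M => //; apply: det1V.
apply: diag_block_det; case: (tok_of i) => [m|x||]; rewrite /tok1 /tok2 /=.
- exact: X1.
- by apply: D => //; apply: det1V.
- by rewrite mul1r.
- exact: det1_exp4.
- by apply: det1M; [apply: det1M => // | apply: det1V].
- by apply: D => //; apply: det1V.
- by apply: det1M => //; apply: det1M.
exact: det1_exp4.
Qed.

End Instance.

(** The values are reversed on purpose: 0 puts the identity into the semigroup and a positive value
    keeps it out, the opposite of a correct answer. *)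
Theorem instance (f : recfun 1) : exists C : 'I_8 -> nat -> 'M[int]_4, forall n,
  let A := [tuple quad (C i) n | i < 8] in
  [/\ forall i, \det (tnth A i) = 1,
      computes f [tuple n] 0 -> in_semigroup A 1%:M &
      forall y, computes f [tuple n] y.+1 -> ~ in_semigroup A 1%:M].
Proof.
have [C EC] := instance_quad f; exists C => n A.
have [yes no] := instance_tokens f n.
have EA' v2 : (forall i, diag_block (tok1 (tok_of i)) (v2 (tok_of i)) = quad (C i) n) ->
    A = [tuple diag_block (tok1 (tok_of i)) (v2 (tok_of i)) | i < 8].
  by move=> E; apply: eq_from_tnth => i; rewrite !tnth_mktuple E.
have EA := EA' _ (fun i => EC i n).
split.
- by move=> i; rewrite tnth_mktuple -EC; apply: instance_det.
- by move=> /yes; rewrite EA => /semigroup_tokens.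
by move=> y /no; rewrite EA => nW /semigroup_tokens.
Qed.

Local Close Scope ring_scope.

Theorem theorem19 :
  undecidable_problem mx_code
    (fun A : 8.-tuple 'M[int]_4 => forall i : 'I_8, (\det (tnth A i) = 1)%R)
    (fun A : 8.-tuple 'M[int]_4 => in_semigroup A (1%:M)%R).
Proof.
case=> d Hd.
have [r Hr] : exists r : 'I_128 -> recfun 1, forall j : 'I_128,
    forall x, computes (r j) x (entry_code j (thead x)).
  apply: (fin_all_exists (P := fun (j : 'I_128) (q : recfun 1) =>
    forall x, computes q x (entry_code j (thead x)))) => j.
  exact: cf1_entry_code.
(* This composite takes its argument as a code of coefficients, computes the entries at that same
   argument and submits them to [d]. *)
have [C HC] := instance (RComp d r).
pose c j k := C (inord (j %/ 16)) k (inord ((j %/ 4) %% 4)) (inord (j %% 4)).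
(* [n] codes the coefficients attached to the composite itself, so at [n] it submits its own
   matrices to [d]. *)
have [n Hn] := entry_surj c 128.
have [detA yes no] := HC n.
have enc v : computes d (mx_code [tuple quad (C i) n | i < 8]) v ->
    computes (RComp d r) [tuple n] v.
  move=> /= Hv; exists (mx_code [tuple quad (C i) n | i < 8]) => // j.
  suff -> : tnth (mx_code [tuple quad (C i) n | i < 8]) j = entry_code j n by apply: Hr.
  rewrite Hn ?ltn_ord // tnth_mktuple; congr int_code.
  by rewrite tnth_mktuple /quad !mxE !mulmxnE.
have [dec1 dec0] := Hd _ detA.
have notI : ~ in_semigroup [tuple quad (C i) n | i < 8] (1%:M)%R.
  by move=> inI; apply: (no 0 _ inI); apply: enc; apply: dec1.
by apply: (notI); apply: yes; apply: enc; apply: dec0.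
Qed.
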